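(* Let $\alpha>0$, let $\varphi\in\mathcal{S}(\mathbb{R})$ be supported in $[\alpha,\alpha+1]$, and set $$u_0(z,t)=\int_{\mathbb{R}}e^{|\lambda|(it-|z|^2/4)}\varphi(\lambda)\,\mathrm{d}\lambda,\qquad (z,t)\in\mathbb{R}^{2n}\times\mathbb{R}.$$ Then $u(z,t,s)=u_0(z,t-ns)$ is a solution of $i\partial_su(z,t,s)+\mathcal{L}u(z,t,s)=0$ with $u(z,t,0)=u_0(z,t)$. For every $s>0$, $$|u(z,t,s)|\le\|\varphi\|_{L^1(\mathbb{R})}\,e^{-\alpha|z|^2/4},$$ and, for every $k\in\mathbb{N}$, $$|u(z,t,s)|\le\|\varphi^{(k)}\|_{L^1(\mathbb{R})}\,\frac{e^{-\alpha|z|^2/4}}{\bigl((t-ns)^2+|z|^4/16\bigr)^{k/2}}.$$ This shows that one cannot take $\delta=0$ in the Hardy-type Dynamical Uncertainty Principle (H) recalled in the context; that is, in the dynamical version of Hardy's Uncertainty Principle on the Heisenberg group, one needs to impose a faster than polynomial decay in the central variable $t$.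
   Context: The Heisenberg group $\mathbb{H}^n$ is $\mathbb{R}^n\times\mathbb{R}^n\times\mathbb{R}$ with elements $(z,t)=(x,y,t)$, $z=(x,y)\in\mathbb{R}^{2n}$, and group law $(x,y,t)(x',y',t')=\bigl(x+x',y+y',t+t'-\tfrac12\sum_{j=1}^n(x_jy_j'-y_jx_j')\bigr)$. Haar measure is Lebesgue measure $\mathrm{d}z\,\mathrm{d}t$. The sub-Laplacian is $\mathcal{L}=\sum_{j=1}^n(X_j^2+Y_j^2)$ with $X_j=\partial_{x_j}+\tfrac12y_j\partial_t$ and $Y_j=\partial_{y_j}-\tfrac12x_j\partial_t$. $\mathcal{S}(\mathbb{R})$ is the Schwartz class and $\varphi^{(k)}$ is the $k$-th derivative of $\varphi$. Hardy-type Dynamical Uncertainty Principle (H) (Ben Saïd, Thangavelu, Dogga): let $u_0\in L^2(\mathbb{H}^n)$ and let $u$ be the solution of $i\partial_su+\mathcal{L}u=0$ with $u(z,t,0)=u_0(z,t)$. Assume that, for some time $T>0$, $|u_0(z,t)|=O(e^{-|z|^2/4a^2-\delta|t|})$ and $|u(z,t,T)|=O(e^{-|z|^2/4b^2-\delta|t|})$ for some $\delta>0$ and $ab<T$. Then $u=0$. *)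

(* Defs.v *)
From HB Require Import structures.
From mathcomp Require Import all_boot all_order all_algebra.
From mathcomp Require Import all_classical all_reals all_analysis.
From mathcomp Require Import complex.
Set Implicit Arguments.
Unset Strict Implicit.
Unset Printing Implicit Defensive.
Import Order.TTheory GRing.Theory Num.Theory.
Import numFieldNormedType.Exports.
Local Open Scope classical_set_scope.
Local Open Scope ring_scope.

(* 'rV[T]_n carries the sigma-algebra generated by the coordinates, as the
   library does for n.-tuple T; for T = R this is the Borel sigma-algebra. *)
Definition row_display (d : measure_display) : measure_display.
Proof. exact d. Qed.

Section measurable_row.
Context {d} {T : sigmaRingType d} {n : nat}.
Let coor (i : 'I_n) (v : 'rV[T]_n) : T := v ord0 i.

Let row_set0 : g_sigma_preimage coor set0.
Proof. exact: sigma_algebra0. Qed.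

Let row_setC A : g_sigma_preimage coor A -> g_sigma_preimage coor (~` A).
Proof. exact: sigma_algebraC. Qed.

Let row_bigcup (F : _^nat) : (forall i, g_sigma_preimage coor (F i)) ->
  g_sigma_preimage coor (\bigcup_i (F i)).
Proof. exact: sigma_algebra_bigcup. Qed.

HB.instance Definition _ := @isMeasurable.Build (row_display d)
  'rV[T]_n (g_sigma_preimage coor) row_set0 row_setC row_bigcup.

End measurable_row.

Lemma measurable_coord d (T : measurableType d) n (i : 'I_n) :
  measurable_fun [set: 'rV[T]_n] (fun v => v ord0 i).
Proof.
move=> _ Y mY; rewrite setTI; apply: sub_sigma_algebra => /=.
rewrite -bigcup_seq/=; exists i => /=; first by rewrite mem_index_enum.
by exists Y => //; rewrite setTI.
Qed.

Lemma measurable_fun_rowP d1 d2 (S : measurableType d1) (T : measurableType d2)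
    n (f : S -> 'rV[T]_n) :
  measurable_fun [set: S] f <->
  forall i, measurable_fun [set: S] (fun x => f x ord0 i).
Proof.
split=> [mf i|mf]; first exact: measurableT_comp (@measurable_coord _ T n i) mf.
apply: (@measurability _ _ _ _ _ f
  (\big[setU/set0]_(i < n) preimage_set_system setT
     (fun v : 'rV[T]_n => v ord0 i) measurable)) => //.
move=> _ [B + <-]; rewrite -bigcup_seq => -[i _ [A mA <-]].
by rewrite setTI; exact: mf.
Qed.

Definition row_cons (T : Type) n (xv : T * 'rV[T]_n) : 'rV[T]_n.+1 :=
  \row_i oapp (xv.2 ord0) xv.1 (unlift ord0 i).

Definition row_uncons (T : Type) n (v : 'rV[T]_n.+1) : T * 'rV[T]_n :=
  (v ord0 ord0, \row_i v ord0 (lift ord0 i)).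

Lemma row_consK T n : cancel (@row_cons T n) (@row_uncons T n).
Proof.
move=> [x v]; congr pair; first by rewrite mxE unlift_none.
by apply/rowP => i; rewrite !mxE liftK.
Qed.

Lemma measurable_row_cons d (T : measurableType d) n :
  measurable_fun setT (@row_cons T n).
Proof.
apply/measurable_fun_rowP => i; rewrite /row_cons.
under eq_fun do rewrite mxE.
case: unliftP => [j _|_] /=; last exact: measurable_fst.
exact: measurableT_comp (@measurable_coord _ T n j) measurable_snd.
Qed.

Lemma measurable_row_uncons d (T : measurableType d) n :
  measurable_fun setT (@row_uncons T n).
Proof.
apply/measurable_fun_pairP; split; first exact: measurable_coord.
apply/measurable_fun_rowP => i /=.
under eq_fun do rewrite mxE.
exact: measurable_coord.
Qed.

(* The product of two sigma-finite measures, with its sigma-finite structure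
   (the library only exports the measure structure on m1 \x m2). *)
Section prod_measure.
Context {d1 d2} {T1 : measurableType d1} {T2 : measurableType d2}.
Context {R : realType}.
Local Open Scope ereal_scope.
Variables (m1 : {sigma_finite_measure set T1 -> \bar R})
          (m2 : {sigma_finite_measure set T2 -> \bar R}).

Definition prod_measure : set (T1 * T2) -> \bar R := m1 \x m2.

HB.instance Definition _ := Measure.copy prod_measure (m1 \x m2).

Let prod_measure_sigma_finite : sigma_finite setT prod_measure.
Proof.
have /sigma_finiteP[F [FT ndF Foo]] := sigma_finiteT m1.
have /sigma_finiteP[G [GT ndG Goo]] := sigma_finiteT m2.
exists (fun k => F k `*` G k) => [|k].
  rewrite -setXTT FT GT; apply/seteqP; split=> -[x y] /=.
    move=> [[i _ Fx] [j _ Gy]]; exists (maxn i j) => //; split.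
      by move: x Fx; exact/subsetPset/ndF/leq_maxl.
    by move: y Gy; exact/subsetPset/ndG/leq_maxr.
  by move=> [k _ [Fx Gy]]; split; exists k.
have [mF Fk] := Foo k; have [mG Gk] := Goo k.
split; first exact: measurableX.
by rewrite /prod_measure product_measure1E// lte_mul_pinfty// ge0_fin_numE.
Qed.

HB.instance Definition _ :=
  Measure_isSigmaFinite.Build _ _ _ prod_measure prod_measure_sigma_finite.

End prod_measure.

Section lebesgue_row.
Context {R : realType}.
Local Open Scope ereal_scope.

Section step.
Variables (n : nat) (mu : {sigma_finite_measure set 'rV[R]_n -> \bar R}).

Definition lebesgue_row_step : set 'rV[R]_n.+1 -> \bar R :=
  pushforward (prod_measure (@lebesgue_measure R) mu) (@row_cons R n).

Let pushm : {measure set 'rV[R]_n.+1 -> \bar R} :=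
  measure_function_pushforward__canonical__measure_function_Measure
    (prod_measure (@lebesgue_measure R) mu) (@measurable_row_cons _ R n).

HB.instance Definition _ := isMeasure.Build _ _ _ lebesgue_row_step
  (measure0 pushm) (measure_ge0 pushm)
  (@measure_semi_sigma_additive _ _ _ pushm).

Let step_sigma_finite : sigma_finite setT lebesgue_row_step.
Proof.
have [F FT Foo] := sigma_finiteT (prod_measure (@lebesgue_measure R) mu).
exists (fun k => @row_uncons R n @^-1` F k).
  by rewrite -preimage_bigcup -FT preimage_setT.
move=> k; have [mF Fk] := Foo k; split.
  rewrite -[X in measurable X]setTI; exact: measurable_row_uncons.
rewrite /lebesgue_row_step /pushforward -comp_preimage.
rewrite (_ : _ \o _ = id) ?preimage_id//.
by apply/funext => xv /=; rewrite row_consK.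
Qed.

HB.instance Definition _ :=
  Measure_isSigmaFinite.Build _ _ _ lebesgue_row_step step_sigma_finite.

End step.

(* Lebesgue measure on R^n; lebesgue_row_box checks it on boxes. *)
Fixpoint lebesgue_row n : {sigma_finite_measure set 'rV[R]_n -> \bar R} :=
  if n is m.+1 then lebesgue_row_step (lebesgue_row m)
  else dirac (0%R : 'rV[R]_0).

Definition row_box n (a b : 'rV[R]_n) : set 'rV[R]_n :=
  [set v | forall i, v ord0 i \in `[a ord0 i, b ord0 i]].

Lemma measurable_row_box n (a b : 'rV[R]_n) : measurable (row_box a b).
Proof.
rewrite (_ : row_box a b = \bigcap_(i in [set: 'I_n])
    ((fun v : 'rV[R]_n => v ord0 i) @^-1` `[a ord0 i, b ord0 i])).
  apply: fin_bigcap_measurable => // i _.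
  by rewrite -[X in measurable X]setTI; exact: measurable_coord.
by apply/seteqP; split => [v vab i _|v vab i]; [exact: vab|exact: vab i I].
Qed.

Lemma lebesgue_row_box n (a b : 'rV[R]_n) :
    (forall i, (a ord0 i <= b ord0 i)%R) ->
  lebesgue_row n (row_box a b) = (\prod_(i < n) (b ord0 i - a ord0 i))%:E.
Proof.
elim: n a b => [|n IH] a b ab.
  by rewrite /= diracE mem_set ?big_ord0// => -[].
rewrite /= /lebesgue_row_step /pushforward /prod_measure.
pose a' := (row_uncons a).2; pose b' := (row_uncons b).2.
rewrite (_ : _ @^-1` _ = `[a ord0 ord0, b ord0 ord0] `*` row_box a' b').
  rewrite product_measure1E//; last exact: measurable_row_box.
  have {}IH := IH a' b'; rewrite [X in _ * X]IH; last first.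
    by move=> i; rewrite !mxE.
  rewrite big_ord_recl EFinM; congr (_ * _%:E).
    apply: etrans (lebesgue_measure_itv `[a ord0 ord0, b ord0 ord0]) _.
    rewrite /= lte_fin; case: ltP => // ba.
    by apply/esym/eqP; rewrite eqe subr_eq0 eq_le ba ab.
  by apply: eq_bigr => i _; rewrite !mxE.
apply/seteqP; split => [[x v] /= H|[x v] /= [xab H] i].
  split; first by have := H ord0; rewrite mxE unlift_none.
  by move=> i; have := H (lift ord0 i); rewrite !mxE liftK.
rewrite mxE; case: unliftP => [j ->|->//] /=.
by have := H j; rewrite !mxE.
Qed.

End lebesgue_row.

(* Points of the Heisenberg group H^n are ((x, y), t). *)
Notation heis R n := ('rV[R]_n * 'rV[R]_n * R)%type.
Notation normc := ComplexField.Normc.normc.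

(* Haar measure dz dt. lebesgue_measure lives on measurableTypeR R, which has the
   same measurable sets as R but another display, hence the rebuilt instances. *)
Section heis_measure.
Context {R : realType} {n : nat}.
Local Open Scope ereal_scope.

Let mu := prod_measure
  (prod_measure (@lebesgue_row R n) (@lebesgue_row R n)) (@lebesgue_measure R).

Definition heis_measure : set (heis R n) -> \bar R := mu.

HB.instance Definition _ := isMeasure.Build _ (heis R n) R heis_measure
  (measure0 mu) (measure_ge0 mu) (@measure_semi_sigma_additive _ _ _ mu).

HB.instance Definition _ := Measure_isSigmaFinite.Build _ (heis R n) R
  heis_measure (sigma_finiteT mu).

End heis_measure.

(* Derivatives, integrals and measurability of complex-valued functions are
   taken on the real and imaginary parts. *)
Section complex_valued.
Context {R : realType}.

Definition cexp (w : R[i]) : R[i] :=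
  (expR (complex.Re w))%:C%C * (cos (complex.Im w) +i* sin (complex.Im w))%C.

Definition cintegral d (T : measurableType d) (mu : {measure set T -> \bar R})
    (f : T -> R[i]) : R[i] :=
  (Rintegral mu setT (fun x => complex.Re (f x)) +i*
   Rintegral mu setT (fun x => complex.Im (f x)))%C.

Definition cmeasurable d (T : measurableType d) (f : T -> R[i]) : Prop :=
  measurable_fun setT (fun x => complex.Re (f x)) /\
  measurable_fun setT (fun x => complex.Im (f x)).

Definition cderivable (V : normedModType R) (f : V -> R[i]) (p v : V) : Prop :=
  derivable (fun q => complex.Re (f q)) p v /\
  derivable (fun q => complex.Im (f q)) p v.

Definition cderive (V : normedModType R) (f : V -> R[i]) (p v : V) : R[i] :=
  ('D_v (fun q => complex.Re (f q)) p +i*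
   'D_v (fun q => complex.Im (f q)) p)%C.

(* C^k on a finite-dimensional V: all iterated directional derivatives of order
   at most k exist and are continuous. *)
Fixpoint Ck (V : normedModType R) (k : nat) (f : V -> R) : Prop :=
  continuous f /\
  if k is k'.+1 then
    forall v, (forall p, derivable f p v) /\ Ck k' (fun p => 'D_v f p)
  else True.

Definition cCk (V : normedModType R) (k : nat) (f : V -> R[i]) : Prop :=
  Ck k (fun p => complex.Re (f p)) /\ Ck k (fun p => complex.Im (f p)).

Definition test_function (V : normedModType R) (psi : V -> R[i]) : Prop :=
  (forall k, cCk k psi) /\ compact (closure [set p | psi p != 0]).

Definition nderiv (k : nat) (phi : R -> R[i]) : R -> R[i] :=
  iter k (fun (f : R -> R[i]) (x : R) => cderive f x (1 : R)) phi.

Definition schwartz (phi : R -> R[i]) : Prop :=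
  (forall k (x : R), cderivable (nderiv k phi) x (1 : R)) /\
  (forall m k, exists M : R, forall x, `|x| ^+ m * normc (nderiv k phi x) <= M).

Definition L1norm (f : R -> R[i]) : \bar R :=
  Lnorm (@lebesgue_measure R) 1%E (fun x => (normc (f x))%:E).

End complex_valued.

Section heisenberg.
Context {R : realType} {n : nat}.
Implicit Types (f psi : heis R n -> R[i]) (p : heis R n).

Definition znorm2 p : R := \sum_(j < n) (p.1.1 ord0 j ^+ 2 + p.1.2 ord0 j ^+ 2).

Definition dir_x (j : 'I_n) : heis R n := (delta_mx ord0 j, 0, 0).
Definition dir_y (j : 'I_n) : heis R n := (0, delta_mx ord0 j, 0).
Definition dir_t : heis R n := (0, 0, 1).

Definition vecX (j : 'I_n) f p : R[i] :=
  cderive f p (dir_x j) + (p.1.2 ord0 j / 2)%:C%C * cderive f p dir_t.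

Definition vecY (j : 'I_n) f p : R[i] :=
  cderive f p (dir_y j) - (p.1.1 ord0 j / 2)%:C%C * cderive f p dir_t.

Definition sublaplacian f p : R[i] :=
  \sum_(j < n) (vecX j (vecX j f) p + vecY j (vecY j f) p).

Definition L2norm f : \bar R :=
  Lnorm (@heis_measure R n) 2%:E (fun p => (normc (f p))%:E).

Definition inL2 f : Prop := cmeasurable f /\ (L2norm f < +oo)%E.

Definition pairing f psi : R[i] := cintegral heis_measure (fun p => f p * psi p).

(* Functions of space and time are written u s p, with s the time. *)
Implicit Types u : R -> heis R n -> R[i].

Definition classical_solution u : Prop :=
  (forall s, cCk 2 (u s)) /\
  forall s p, cderivable (fun r : R => u r p) s (1 : R) /\
    'i%C * cderive (fun r : R => u r p) s (1 : R) + sublaplacian (u s) p = 0.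

(* u is the solution in C(R; L^2(H^n)) of i d_s u + L u = 0 with datum u0 in
   L^2(H^n): the equation is tested against C_c^oo(H^n), where L is its own
   transpose. As L is essentially self-adjoint on C_c^oo(H^n), this says that
   u s = e^{isL} u0 for all s. *)
Definition L2_solution (u0 : heis R n -> R[i]) u : Prop :=
  [/\ inL2 u0,
      forall s, inL2 (u s),
      {ae heis_measure, forall p, u 0 p = u0 p},
      forall s, L2norm (fun p => u r p - u s p) @[r --> s] --> 0%E
    & forall psi, test_function psi -> forall s,
        cderivable (fun r : R => pairing (u r) psi) s (1 : R) /\
        'i%C * cderive (fun r : R => pairing (u r) psi) s (1 : R)
          + pairing (u s) (sublaplacian psi) = 0].

(* f(z,t) = O(e^{-|z|^2/4a^2} w(t)), f being defined up to null sets *)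
Definition gaussian_decay (a : R) (w : R -> R) f : Prop :=
  exists K : R, {ae heis_measure, forall p,
    normc (f p) <= K * (expR (- znorm2 p / (4 * a ^+ 2)) * w p.2)}.

(* The implication in the Hardy-type dynamical uncertainty principle, with decay
   w in the central variable. The principle itself is this implication for all
   a, b, T, delta > 0 with a * b < T and w t = e^{-delta |t|}. *)
Definition hardy_dynamical (w : R -> R) (a b T : R) : Prop :=
  forall (u0 : heis R n -> R[i]) u, L2_solution u0 u ->
    gaussian_decay a w u0 -> gaussian_decay b w (u T) ->
    forall s, {ae heis_measure, forall p, u s p = 0}.

Definition packet_init (phi : R -> R[i]) p : R[i] :=
  cintegral (@lebesgue_measure R) (fun l : R =>
    cexp (`|l|%:C%C * ('i%C * p.2%:C%C - (znorm2 p / 4)%:C%C)) * phi l).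

Definition packet (phi : R -> R[i]) (s : R) p : R[i] :=
  packet_init phi (p.1, p.2 - n%:R * s).

End heisenberg.
Arguments hardy_dynamical {R} n w a b T.

(* Main.v *)
Require Import Defs.
From mathcomp Require Import all_boot all_order all_algebra.
From mathcomp Require Import all_classical all_reals all_analysis.
From mathcomp Require Import measurable_realfun.
From mathcomp Require Import complex ring lra.
Set Implicit Arguments.
Unset Strict Implicit.
Unset Printing Implicit Defensive.
Import Order.TTheory GRing.Theory Num.Theory.
Import numFieldNormedType.Exports.
Local Open Scope classical_set_scope.
Local Open Scope ring_scope.

(* For l > 0 the function exp (l w), w = i t - |z|^2 / 4, satisfies
   X_j exp (l w) = l (- x_j + i y_j) / 2 exp (l w) and
   Y_j exp (l w) = l (- y_j - i x_j) / 2 exp (l w), and the squares of the two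
   symbols cancel; hence L exp (l w) = - n l exp (l w), and the Schroedinger
   flow multiplies the frequency l by exp (- i n l s), which is the translation
   of t by n s. Integrating by parts k times in l gives
   w^k u_0 = (-1)^k \int exp (l w) phi^(k)(l) dl, whence the polynomial decay,
   with the Gaussian factor because l >= alpha on the support of phi.
   In particular u and its time derivative are dominated by a multiple of
   \prod 1 / (1 + x^2) over the 2 n + 1 coordinates, which is integrable; this
   yields continuity in L^2. The weak equation follows from the classical one as
   X_j and Y_j are divergence free. A bump function phi and
   alpha = a^-2 + b^-2 then contradict the dynamical uncertainty principle for
   polynomial weights. *)

(** * Haar measure on the Heisenberg group *)

(** The datum depends on the point only through the complex number [w], which stays in the
    half-plane [Re w <= 0]. Differentiating in [w] multiplies the profile [phi] by [l], bounded on
    the support, so every derivative in space or time is a combination of packets with polynomial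
    coefficients, and the flow merely replaces the profile by another one of the same class. As
    alpha > 0, [|l|] equals [l] there and frequency zero causes no singularity. Two arguments need
    an integrable majorant that is stable under translation: packets slide along t as time passes,
    and difference quotients sample neighbouring points. A Gaussian is not bounded by a multiple of
    its translates, whereas [1 / (1 + x^2)] is, with a constant depending only on the shift; hence
    an algebraic majorant even in z, where the decay is Gaussian. The divergence theorem then
    reduces to translation invariance of the measure, without boundary terms. Nonvanishing is tested
    at the origin, where the initial packet equals the integral of the bump. *)

Section heis_tonelli.
Context {R : realType}.
Local Open Scope ereal_scope.
Local Notation leb := (@lebesgue_measure R).

(** Lebesgue measure is determined by its values on half-open intervals, whose lengths a translation
    preserves. *)
Lemma lebesgue_measure_pushforwardD (c : R) (A : set (measurableTypeR R)) :
  measurable A ->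
  pushforward leb (fun x : measurableTypeR R => (x + c)%R : measurableTypeR R) A = leb A.
Proof.
have mc : measurable_fun setT (fun x : measurableTypeR R => (x + c)%R : measurableTypeR R).
  exact: measurable_funD.
pose nu : {measure set (measurableTypeR R) -> \bar R} :=
  measure_function_pushforward__canonical__measure_function_Measure leb mc.
move=> mA; rewrite -[LHS]/(nu A); apply/esym.
apply: lebesgue_measure_unique => // X [[a b] /= ab <-].
rewrite /nu /= /pushforward.
rewrite (_ : _ @^-1` _ = `](a - c)%R, (b - c)%R]%classic).
  rewrite !lebesgue_measure_itv /= !lte_fin ltrD2r -!EFinB.
  by rewrite (_ : (b - c - (a - c) = b - a)%R)//; ring.
by apply/seteqP; split => x /=; rewrite !in_itv /= ltrBlDr lerBrDr.
Qed.

Lemma ge0_integral_lebesgueD (c : R) (f : measurableTypeR R -> \bar R) :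
  measurable_fun setT f -> (forall x, 0 <= f x) ->
  \int[leb]_x f (x + c)%R = \int[leb]_x f x.
Proof.
move=> mf f0.
have mc : measurable_fun setT (fun x : measurableTypeR R => (x + c)%R : measurableTypeR R).
  exact: measurable_funD.
have := @ge0_integral_pushforward _ _ _ _ R _ mc leb setT f measurableT mf (fun x _ => f0 x).
rewrite preimage_setT => H; apply: etrans (esym H) _.
apply: eq_measure_integral => A mA _; exact: lebesgue_measure_pushforwardD.
Qed.

Lemma row_tonelli n (f : 'rV[R]_n.+1 -> \bar R) :
  measurable_fun setT f -> (forall v, 0 <= f v) ->
  \int[@lebesgue_row R n.+1]_v f v =
  \int[leb]_x \int[@lebesgue_row R n]_v f (row_cons (x : R, v)).
Proof.
move=> mf f0.
have mc : measurable_fun (setT : set (measurableTypeR R * 'rV[R]_n))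
    (@row_cons R n : measurableTypeR R * 'rV[R]_n -> 'rV[R]_n.+1).
  exact: (@measurable_row_cons _ R n).
have := @ge0_integral_pushforward _ _ _ _ R _ mc
  (prod_measure leb (lebesgue_row n)) setT f measurableT mf (fun x _ => f0 x).
rewrite preimage_setT => H; apply: etrans H _.
apply: fubini_tonelli1 => [|x]; last exact: f0.
exact: measurableT_comp mf mc.
Qed.

(* [heis_measure] and the product measure live on measurable types with the same
   measurable sets but different displays; the identity map transports one to the other. *)
Lemma heis_tonelli n (f : heis R n -> \bar R) :
  measurable_fun setT f -> (forall p, 0 <= f p) ->
  \int[heis_measure]_p f p =
  \int[lebesgue_row n]_x \int[lebesgue_row n]_y \int[leb]_t f (x, y, t).
Proof.
move=> mf f0.
pose T' := ('rV[R]_n * 'rV[R]_n * measurableTypeR R)%type.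
have mid : measurable_fun (setT : set T') (fun p : T' => p : heis R n).
  by move=> _ A mA; rewrite setTI.
pose mu := prod_measure (prod_measure (@lebesgue_row R n) (@lebesgue_row R n)) leb.
have := @ge0_integral_pushforward _ _ _ _ R _ mid mu setT f measurableT mf (fun x _ => f0 x).
rewrite preimage_setT => H.
transitivity (\int[pushforward mu (fun p : T' => p : heis R n)]_y f y).
  by apply: eq_measure_integral.
have mf' : measurable_fun (setT : set T') (f : T' -> \bar R).
  exact: measurableT_comp mf mid.
apply: etrans H _.
have f0' : forall x : T', 0 <= f x by move=> x; exact: f0.
pose rr := prod_measure (@lebesgue_row R n) (@lebesgue_row R n).
apply: etrans (@fubini_tonelli1 _ _ _ _ R rr leb f mf' f0') _.
have m2 := @measurable_fun_fubini_tonelli_F _ _ _ _ R leb f mf' f0'.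
apply: etrans (@fubini_tonelli1 _ _ _ _ R (lebesgue_row n) (lebesgue_row n) _ m2 _) _ => //.
by move=> x; apply: integral_ge0.
Qed.
End heis_tonelli.

(** * Translation invariance of the measure *)

Section heis_translation.
Context {R : realType}.
Local Open Scope ereal_scope.
Local Notation leb := (@lebesgue_measure R).

Lemma measurable_funEFin d (T : measurableType d) (f : T -> R) :
  measurable_fun setT f -> measurable_fun setT (fun x => (f x)%:E).
Proof. by move=> mf; exact/measurable_EFinP. Qed.

Lemma measurable_row_section n (f : 'rV[R]_n.+1 -> \bar R) (x : R) :
  measurable_fun setT f ->
  measurable_fun setT (fun v : 'rV[R]_n => f (row_cons (x, v))).
Proof.
move=> mf; apply: (measurableT_comp mf).
exact: (measurableT_comp (@measurable_row_cons _ R n) (measurable_pair1 x)).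
Qed.

Lemma measurable_row_tonelli n (f : 'rV[R]_n.+1 -> \bar R) :
  measurable_fun setT f -> (forall v, 0 <= f v) ->
  measurable_fun (setT : set (measurableTypeR R))
    (fun x : R => \int[@lebesgue_row R n]_v f (row_cons (x, v))).
Proof.
move=> mf f0.
pose g (p : measurableTypeR R * 'rV[R]_n) := f (row_cons (p : R * 'rV[R]_n)).
have mg : measurable_fun setT g.
  have mc : measurable_fun (setT : set (measurableTypeR R * 'rV[R]_n))
    (@row_cons R n : measurableTypeR R * 'rV[R]_n -> 'rV[R]_n.+1).
    exact: (@measurable_row_cons _ R n).
  exact: measurableT_comp mf mc.
by have := @measurable_fun_fubini_tonelli_F _ _ _ _ R (lebesgue_row n) g mg
  (fun p => f0 _).
Qed.

Lemma measurable_rowD n (w : 'rV[R]_n) :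
  measurable_fun setT (fun v : 'rV[R]_n => (v + w)%R).
Proof.
apply/measurable_fun_rowP => i; under eq_fun do rewrite mxE.
by apply: measurable_funD => //; exact: measurable_coord.
Qed.

Lemma row_consD n (x y : R) (v w : 'rV[R]_n) :
  (row_cons (x, v) + row_cons (y, w) = row_cons (x + y, v + w))%R.
Proof. by apply/rowP => i; rewrite !mxE; case: unliftP => [j _|_] //=; rewrite mxE. Qed.

Lemma row_unconsK (T : Type) n : cancel (@row_uncons T n) (@row_cons T n).
Proof. by move=> v; apply/rowP => i; rewrite mxE; case: unliftP => [j ->|->] //=; rewrite mxE. Qed.

(** Induction on the dimension: Tonelli separates the first coordinate, so that one translation on
    the line and one in dimension [n] remain. In dimension 0 the only vector is 0. *)
Lemma ge0_integral_rowD n (w : 'rV[R]_n) (f : 'rV[R]_n -> \bar R) :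
  measurable_fun setT f -> (forall v, 0 <= f v) ->
  \int[lebesgue_row n]_v f (v + w)%R = \int[lebesgue_row n]_v f v.
Proof.
elim: n w f => [|n IH] w f mf f0.
  by apply: eq_integral => v _; congr f; rewrite [w]thinmx0 addr0.
rewrite -[w](row_unconsK); move: (row_uncons w) => -[y {}w].
have mfw : measurable_fun setT (fun v : 'rV[R]_n.+1 => f (v + row_cons (y, w))%R).
  exact: (measurableT_comp mf (measurable_rowD _)).
rewrite (row_tonelli mfw (fun v => f0 _)) (row_tonelli mf f0).
under eq_integral => x _ do under eq_integral => v _ do rewrite row_consD.
under eq_integral => x _.
  rewrite (IH w (fun v => f (row_cons ((x + y)%R, v))))//; last exact: measurable_row_section.
  over.
apply: (@ge0_integral_lebesgueD R y (fun x => \int[lebesgue_row n]_v f (row_cons (x : R, v)))).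
  exact: measurable_row_tonelli.
by move=> x; apply: integral_ge0.
Qed.

Lemma measurable_heisP d (S : measurableType d) n (f : S -> heis R n) :
  (forall j, measurable_fun setT (fun s => (f s).1.1 ord0 j)) ->
  (forall j, measurable_fun setT (fun s => (f s).1.2 ord0 j)) ->
  measurable_fun setT (fun s => (f s).2) ->
  measurable_fun setT f.
Proof.
move=> m1 m2 m3; apply/measurable_fun_pairP; split => //.
by apply/measurable_fun_pairP; split; apply/measurable_fun_rowP.
Qed.

Lemma measurable_heis_x n j : measurable_fun setT (fun p : heis R n => p.1.1 ord0 j).
Proof.
apply: (measurableT_comp (@measurable_coord _ R n j)).
exact: measurableT_comp measurable_fst measurable_fst.
Qed.

Lemma measurable_heis_y n j : measurable_fun setT (fun p : heis R n => p.1.2 ord0 j).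
Proof.
apply: (measurableT_comp (@measurable_coord _ R n j)).
exact: measurableT_comp measurable_snd measurable_fst.
Qed.

Lemma measurable_heis_t n : measurable_fun setT (fun p : heis R n => p.2).
Proof. exact: measurable_snd. Qed.

Lemma measurable_heisD n (w : heis R n) :
  measurable_fun setT (fun p : heis R n => (p + w)%R).
Proof.
apply: measurable_heisP => [j|j|] /=; under eq_fun do rewrite ?mxE.
- apply: measurable_funD => //; exact: measurable_heis_x.
- apply: measurable_funD => //; exact: measurable_heis_y.
- apply: measurable_funD => //; exact: measurable_heis_t.
Qed.

Lemma measurable_heis_t_section n (f : heis R n -> \bar R) x y :
  measurable_fun setT f ->
  measurable_fun (setT : set (measurableTypeR R)) (fun t : R => f (x, y, t)).
Proof.
move=> mf; exact: (measurableT_comp mf (@measurable_pair1 _ _ _ R (x, y))).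
Qed.

Lemma measurable_heis_tonelli n (f : heis R n -> \bar R) :
  measurable_fun setT f -> (forall v, 0 <= f v) ->
  measurable_fun setT (fun z : 'rV[R]_n * 'rV[R]_n => \int[leb]_t f (z, t : R)).
Proof.
move=> mf f0.
pose g (p : ('rV[R]_n * 'rV[R]_n) * measurableTypeR R) := f (p : heis R n).
have mg : measurable_fun setT g.
  have mid : measurable_fun setT (fun p : ('rV[R]_n * 'rV[R]_n) * measurableTypeR R => p : heis R n).
    by move=> _ A mA; rewrite setTI.
  exact: measurableT_comp mf mid.
by have := @measurable_fun_fubini_tonelli_F _ _ _ _ R leb g mg (fun p => f0 _).
Qed.

(** Here [+] is the addition of the vector space, not the group law: the directional derivatives to
    be integrated are limits of differences along straight lines. Tonelli undoes the shift in t,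
    then in y, then in x. *)
Lemma ge0_integral_heisD n (w : heis R n) (f : heis R n -> \bar R) :
  measurable_fun setT f -> (forall v, 0 <= f v) ->
  \int[heis_measure]_p f (p + w)%R = \int[heis_measure]_p f p.
Proof.
move=> mf f0.
have mfw : measurable_fun setT (fun p : heis R n => f (p + w)%R).
  exact: (measurableT_comp mf (measurable_heisD w)).
rewrite (heis_tonelli mfw (fun p => f0 _)) (heis_tonelli mf f0).
move: {mfw} w => w.
case: w => [[wx wy] wt].
pose F (z : 'rV[R]_n * 'rV[R]_n) := \int[leb]_t f (z, t : R).
have mF : measurable_fun setT F by exact: measurable_heis_tonelli.
have F0 z : 0 <= F z by exact: integral_ge0.
transitivity (\int[lebesgue_row n]_x \int[lebesgue_row n]_y F (x + wx, y + wy)%R).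
  apply: eq_integral => x _; apply: eq_integral => y _.
  apply: (@ge0_integral_lebesgueD R wt (fun t : R => f (x + wx, y + wy, t)%R)) => //.
  exact: measurable_heis_t_section.
transitivity (\int[lebesgue_row n]_x \int[lebesgue_row n]_y F (x + wx, y)%R).
  apply: eq_integral => x _.
  apply: (@ge0_integral_rowD n wy (fun y => F (x + wx, y)%R)) => //.
  exact: measurableT_comp mF (measurable_pair1 _).
apply: (@ge0_integral_rowD n wx (fun x => \int[lebesgue_row n]_y F (x, y)%R)) => //.
  exact: (@measurable_fun_fubini_tonelli_F _ _ _ _ R (lebesgue_row n) F mF F0).
by move=> x; exact: integral_ge0.
Qed.

Lemma integral_row_prod n (g : R -> R) (c : R) :
  measurable_fun setT g -> (forall x, (0 <= g x)%R) ->
  \int[leb]_x (g x)%:E = c%:E ->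
  \int[lebesgue_row n]_v (\prod_(j < n) g (v ord0 j))%R%:E = (c ^+ n)%:E.
Proof.
move=> mg g0 gc; elim: n => [|n IH].
  under eq_integral do rewrite big_ord0.
  by rewrite integral_cst//= diracE mem_set// mule1.
have c0 : (0 <= c)%R by rewrite -lee_fin -gc; apply: integral_ge0 => x _; rewrite lee_fin.
have mprod m : measurable_fun setT (fun v : 'rV[R]_m => (\prod_(j < m) g (v ord0 j))%R).
  apply: measurable_prod => j _.
  exact: measurableT_comp mg (@measurable_coord _ R m j).
have prod0 m (v : 'rV[R]_m) : (0 <= \prod_(j < m) g (v ord0 j))%R.
  by apply: prodr_ge0.
rewrite row_tonelli//; first last.
- by move=> v; rewrite lee_fin.
- by apply: measurable_funEFin; exact: mprod.
transitivity (\int[leb]_x (\int[lebesgue_row n]_v ((g x)%:E * (\prod_(j < n) g (v ord0 j))%R%:E))).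
  apply: eq_integral => x _; apply: eq_integral => v _.
  rewrite big_ord_recl -EFinM; congr (_ * _)%:E; first by rewrite mxE unlift_none.
  by apply: eq_bigr => i _; rewrite mxE liftK.
transitivity (\int[leb]_x ((g x)%:E * (c ^+ n)%:E)).
  apply: eq_integral => x _; rewrite ge0_integralZl//; last 3 first.
  - by apply: measurable_funEFin; exact: mprod.
  - by move=> v _; rewrite lee_fin.
  - by rewrite lee_fin.
  by rewrite IH.
rewrite ge0_integralZr//.
- by rewrite gc exprS -EFinM.
- exact: measurable_funEFin.
- by move=> x _; rewrite lee_fin.
- by rewrite lee_fin exprn_ge0.
Qed.

End heis_translation.

(** * Tensor products of a function of one variable *)

Section heis_product_functions.
Context {R : realType}.
Local Open Scope ereal_scope.
Local Notation leb := (@lebesgue_measure R).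

(** Used with two profiles: [cauchy_fun], which gives the integrable majorant, and the indicator of
    an interval, which gives the indicator of a cube. *)
Definition heis_prod n (g : R -> R) (p : heis R n) : R :=
  ((\prod_(j < n) g (p.1.1 ord0 j)) * (\prod_(j < n) g (p.1.2 ord0 j)) * g p.2)%R.

Lemma measurable_heis_prod n (g : R -> R) :
  measurable_fun setT g -> measurable_fun setT (@heis_prod n g).
Proof.
move=> mg; apply: measurable_funM; first apply: measurable_funM.
- apply: measurable_prod => j _; exact: measurableT_comp mg (measurable_heis_x _).
- apply: measurable_prod => j _; exact: measurableT_comp mg (measurable_heis_y _).
- exact: measurableT_comp mg (@measurable_heis_t _ _).
Qed.

Lemma heis_prod_ge0 n (g : R -> R) (p : heis R n) :
  (forall x, (0 <= g x)%R) -> (0 <= heis_prod g p)%R.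
Proof. by move=> g0; rewrite /heis_prod !mulr_ge0// prodr_ge0. Qed.

Lemma integral_heis_prod n (g : R -> R) (c : R) :
  measurable_fun setT g -> (forall x, (0 <= g x)%R) ->
  \int[leb]_x (g x)%:E = c%:E ->
  \int[heis_measure]_p (@heis_prod n g p)%:E = (c ^+ (n + n).+1)%:E.
Proof.
move=> mg g0 gc.
have c0 : (0 <= c)%R by rewrite -lee_fin -gc; apply: integral_ge0 => x _; rewrite lee_fin.
have mprod m : measurable_fun setT (fun v : 'rV[R]_m => (\prod_(j < m) g (v ord0 j))%R).
  apply: measurable_prod => j _.
  exact: measurableT_comp mg (@measurable_coord _ R m j).
have prod0 m (v : 'rV[R]_m) : (0 <= \prod_(j < m) g (v ord0 j))%R.
  by apply: prodr_ge0.
rewrite heis_tonelli//; first last.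
- by move=> p; rewrite lee_fin heis_prod_ge0.
- apply: measurable_funEFin; exact: (measurable_heis_prod mg).
have mg' : measurable_fun (setT : set (measurableTypeR R)) (EFin \o g).
  exact: measurable_funEFin.
transitivity (\int[lebesgue_row n]_x \int[lebesgue_row n]_y
    ((\prod_(j < n) g (x ord0 j))%R%:E * (\prod_(j < n) g (y ord0 j))%R%:E * c%:E)).
  apply: eq_integral => x _; apply: eq_integral => y _.
  under eq_integral do rewrite /heis_prod /= !EFinM.
  rewrite ge0_integralZl//; first by rewrite gc.
  - by move=> z _; rewrite lee_fin.
  - by rewrite -EFinM lee_fin; apply: mulr_ge0; exact: prod0.
transitivity (\int[lebesgue_row n]_x
    ((\prod_(j < n) g (x ord0 j))%R%:E * (c ^+ n * c)%R%:E)).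
  apply: eq_integral => x _.
  rewrite ge0_integralZr//; last 2 first.
  - apply: emeasurable_funM; first exact: measurable_cst.
    by apply: measurable_funEFin; exact: mprod.
  - by move=> z _; rewrite -EFinM lee_fin; apply: mulr_ge0; exact: prod0.
  rewrite ge0_integralZl//; last 3 first.
  - by apply: measurable_funEFin; exact: mprod.
  - by move=> z _; rewrite lee_fin; exact: prod0.
  - by rewrite lee_fin; exact: prod0.
  by rewrite (integral_row_prod _ mg g0 gc) -muleA -EFinM.
rewrite ge0_integralZr//; last 3 first.
- by apply: measurable_funEFin; exact: mprod.
- by move=> z _; rewrite lee_fin; exact: prod0.
- by rewrite lee_fin mulr_ge0// exprn_ge0.
by rewrite (integral_row_prod _ mg g0 gc) -EFinM mulrA -exprD -exprSr.
Qed.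

(** The Cauchy density up to the factor pi. It is integrable, dominates Gaussians and is comparable
    with its translates. *)
Definition cauchy_fun (x : R) : R := ((1 + x ^+ 2)^-1)%R.

Lemma cauchy_fun_gt0 x : (0 < cauchy_fun x)%R.
Proof. by rewrite invr_gt0 ltr_wpDr// ?sqr_ge0. Qed.

Lemma measurable_cauchy_fun : measurable_fun setT cauchy_fun.
Proof. exact: continuous_measurable_fun (@continuous_oneDsqrV R). Qed.

Lemma integral_cauchy_fun : \int[leb]_x (cauchy_fun x)%:E = (pi : R)%:E.
Proof.
have := @ge0_symfun_integralT R cauchy_fun (fun x => ltW (cauchy_fun_gt0 x)) (@continuous_oneDsqrV R).
move=> -> //; last by move=> x; rewrite /= /cauchy_fun sqrrN.
rewrite -[[set x | _]]set_itvcy [X in _ * X](@integral0y_oneDsqr R) -EFinM; congr (_%:E); lra.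
Qed.

Lemma integrable_heis_cauchy n :
  heis_measure.-integrable setT (EFin \o @heis_prod n cauchy_fun).
Proof.
apply/integrableP; split.
  exact: (measurable_funEFin (measurable_heis_prod measurable_cauchy_fun)).
under eq_integral => p _.
  rewrite gee0_abs; last by rewrite lee_fin; apply: heis_prod_ge0 => x; rewrite ltW// cauchy_fun_gt0.
  over.
rewrite (integral_heis_prod n measurable_cauchy_fun _ integral_cauchy_fun) ?ltry//.
by move=> x; rewrite ltW// cauchy_fun_gt0.
Qed.

End heis_product_functions.

(** * Measurability of continuous functions *)

Section continuous_measurable.
Context {R : realType}.

Definition grid_round (k : nat) (x : R) : R := (Num.floor (k.+1%:R * x))%:~R / k.+1%:R.

Lemma round_dist k x : `|grid_round k x - x| <= k.+1%:R^-1.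
Proof.
have k0 : 0 < k.+1%:R :> R by rewrite ltr0n.
have -> : grid_round k x - x = ((Num.floor (k.+1%:R * x))%:~R - k.+1%:R * x) / k.+1%:R.
  by rewrite /grid_round mulrBl [k.+1%:R * x]mulrC mulfK// gt_eqF.
rewrite normrM normfV (gtr0_norm k0) ler_piMl ?invr_ge0 ?(ltW k0)//.
have := Num.Theory.ge_floor (k.+1%:R * x).
have := Num.Theory.floorD1_gt (k.+1%:R * x).
rewrite intrD => h1 h2; rewrite ler_norml; apply/andP; split; lra.
Qed.

Definition heis_round n k (p : heis R n) : heis R n :=
  (map_mx (grid_round k) p.1.1, map_mx (grid_round k) p.1.2, grid_round k p.2).

(** Balls of the product uniform structure are cubes, so closeness may be checked one coordinate at
    a time. *)
Lemma heis_ball n (p q : heis R n) (e : R) : 0 < e ->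
  (forall j, `|p.1.1 ord0 j - q.1.1 ord0 j| < e) ->
  (forall j, `|p.1.2 ord0 j - q.1.2 ord0 j| < e) ->
  `|p.2 - q.2| < e -> ball p e q.
Proof.
move=> e0 h1 h2 h3; split; first split.
- by split => // i j; rewrite (ord1 i); exact: h1.
- by split => // i j; rewrite (ord1 i); exact: h2.
- exact: h3.
Qed.

Lemma heis_round_cvg n (p : heis R n) : heis_round k p @[k --> \oo] --> p.
Proof.
apply/cvg_ballP => e e0.
have [N _ HN] := @cvgr_dist_lt _ _ _ _ _ _ _ (@cvg_harmonic R) e e0.
exists N => // k /= Nk.
have ke : k.+1%:R^-1 < e.
  by have := HN k Nk; rewrite /= sub0r normrN gtr0_norm// invr_gt0 ltr0n.
by apply: heis_ball => // [j|j|] /=; rewrite ?mxE distrC; apply: le_lt_trans (round_dist _ _) ke.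
Qed.

(* [f] is the pointwise limit of its values at rounded points, which are countably many. *)
Lemma continuous_measurable_heis n (f : heis R n -> R) :
  continuous f -> measurable_fun setT f.
Proof.
move=> cf; apply: (@measurable_fun_cvg _ _ _ setT (fun k p => f (heis_round k p))); last first.
  by move=> p _; apply: (cvg_comp _ _ (@heis_round_cvg n p)); exact: cf.
move=> k.
(* Rounding factors through a countable type: [c] returns the integer indices of the grid cell of a
   point, [r] the corner of that cell. *)
pose c (p : heis R n) : ('rV[int]_n * 'rV[int]_n * int)%type :=
  (map_mx (fun x => Num.floor (k.+1%:R * x)) p.1.1,
   map_mx (fun x => Num.floor (k.+1%:R * x)) p.1.2, Num.floor (k.+1%:R * p.2)).
pose r (z : ('rV[int]_n * 'rV[int]_n * int)%type) : heis R n :=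
  (map_mx (fun a : int => a%:~R / k.+1%:R) z.1.1, map_mx (fun a : int => a%:~R / k.+1%:R) z.1.2,
   z.2%:~R / k.+1%:R).
have rc p : heis_round k p = r (c p).
  by congr (_, _, _); apply/rowP => j; rewrite !mxE.
have mfl : measurable_fun setT (fun x : R => ((Num.floor x)%:~R : R)).
  apply: nondecreasing_measurable => // x y xy; rewrite ler_int; exact: Num.Theory.le_floor.
have mfl1 (a : int) (h : heis R n -> R) : measurable_fun setT h ->
    measurable [set p : heis R n | Num.floor (k.+1%:R * h p) = a].
  move=> mh.
  rewrite (_ : [set _ | _] = setT `&` (fun p => (Num.floor (k.+1%:R * h p))%:~R : R) @^-1` [set a%:~R]).
    apply: (measurableT_comp mfl) => //.
    by apply: measurable_funM.
  by apply/seteqP; split => [p /= ->//|p /= [_ /eqP]]; rewrite eqr_int => /eqP.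
move=> _ B mB; rewrite setTI.
(* The rounded function is constant on cells, so the preimage of [B] is the countable union of the
   cells whose corner value lies in [B]. *)
rewrite (_ : _ @^-1` _ = \bigcup_z (if f (r z) \in B then c @^-1` [set z] else set0)).
  apply: countable_bigcupT_measurable => // z.
  case: ifP => // _.
  rewrite (_ : c @^-1` _ = 
    (\bigcap_(j in [set: 'I_n]) [set p : heis R n | Num.floor (k.+1%:R * p.1.1 ord0 j) = z.1.1 ord0 j]) `&`
    (\bigcap_(j in [set: 'I_n]) [set p : heis R n | Num.floor (k.+1%:R * p.1.2 ord0 j) = z.1.2 ord0 j]) `&`
    [set p : heis R n | Num.floor (k.+1%:R * p.2) = z.2]).
    apply: measurableI; first apply: measurableI.
    - by apply: fin_bigcap_measurable => // j _; apply: mfl1 => //; exact: measurable_heis_x.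
    - by apply: fin_bigcap_measurable => // j _; apply: mfl1 => //; exact: measurable_heis_y.
    - by apply: mfl1 => //; exact: measurable_heis_t.
  apply/seteqP; split => [p /= <- /=|[[x y] t] /=].
    by do 2 split => //; move=> j _ /=; rewrite mxE.
  case: z => [[a b] m] /= [[h1 h2] h3]; rewrite /c /=; congr (_, _, _) => //.
  - by apply/rowP => j; rewrite mxE (h1 j I).
  - by apply/rowP => j; rewrite mxE (h2 j I).
apply/seteqP; split => [p /= Bp|p [z _]] /=.
  by exists (c p) => //; rewrite -rc mem_set.
by case: ifPn => // /set_mem + /= cz; rewrite -cz -rc.
Qed.

End continuous_measurable.

(** * Dominated functions and the divergence theorem *)

Section heis_integral.
Context {R : realType} {n : nat}.
Local Notation W := (@heis_prod R n cauchy_fun).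

Lemma integral_heisD (w : heis R n) (f : heis R n -> \bar R) :
  measurable_fun setT f ->
  (\int[heis_measure]_p f (p + w)%R = \int[heis_measure]_p f p)%E.
Proof.
move=> mf; rewrite integralE [in RHS]integralE; congr (_ - _)%E.
- rewrite -(@ge0_integral_heisD _ _ w _ (measurable_funepos mf) (fun p => funepos_ge0 f p)).
  by apply: eq_integral => p _; rewrite !funeposE.
- rewrite -(@ge0_integral_heisD _ _ w _ (measurable_funeneg mf) (fun p => funeneg_ge0 f p)).
  by apply: eq_integral => p _; rewrite !funenegE.
Qed.

(* A dominating class that, unlike compact support, contains the wave packets. *)
Definition tame (f : heis R n -> R) : Prop :=
  continuous f /\ exists C, forall p, `|f p| <= C * W p.

Lemma heis_cauchy_gt0 (p : heis R n) : 0 < W p.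
Proof.
by rewrite !mulr_gt0// ?cauchy_fun_gt0//; apply: prodr_gt0 => j _; exact: cauchy_fun_gt0.
Qed.

Lemma tame_integrable f : tame f -> heis_measure.-integrable setT (EFin \o f).
Proof.
move=> [cf [C Cf]].
apply: (@le_integrable _ _ _ _ setT _ _ (fun p => (C%:E * (EFin \o W) p)%E)) => //.
- exact: (measurable_funEFin (continuous_measurable_heis cf)).
- move=> p _; rewrite /= lee_fin; apply: le_trans (Cf p) _; exact: ler_norm.
- exact: integrableZl (integrable_heis_cauchy n).
Qed.

Lemma cauchy_fun_shift (x a : R) : cauchy_fun (x + a) <= 2 * (1 + a ^+ 2) * cauchy_fun x.
Proof.
rewrite /cauchy_fun -[leLHS]mul1r ler_pdivrMr ?ltr_wpDr ?sqr_ge0//.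
rewrite mulrAC ler_pdivlMr ?ltr_wpDr ?sqr_ge0// mul1r.
(* The difference of the two sides of the bound is a sum of squares plus 1, by the parallelogram law
   x^2 + (x + 2a)^2 = 2 (x + a)^2 + 2 a^2. *)
have -> : 2 * (1 + a ^+ 2) * (1 + (x + a) ^+ 2) =
  1 + x ^+ 2 + ((x + 2 * a) ^+ 2 + 2 * (a * (x + a)) ^+ 2 + 1) by ring.
by rewrite lerDl !addr_ge0// ?sqr_ge0// mulr_ge0// sqr_ge0.
Qed.

Lemma prod_cauchy_shift m (v w : 'I_m -> R) :
  \prod_(j < m) cauchy_fun (v j + w j) <=
  (\prod_(j < m) (2 * (1 + w j ^+ 2))) * \prod_(j < m) cauchy_fun (v j).
Proof.
rewrite -big_split/=; apply: ler_prod => j _.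
by rewrite (ltW (cauchy_fun_gt0 _))/= cauchy_fun_shift.
Qed.

Definition shift_bound (w : heis R n) : R :=
  (\prod_(j < n) (2 * (1 + w.1.1 ord0 j ^+ 2))) *
  (\prod_(j < n) (2 * (1 + w.1.2 ord0 j ^+ 2))) * (2 * (1 + w.2 ^+ 2)).

Lemma heis_cauchy_shift (p w : heis R n) : W (p + w) <= shift_bound w * W p.
Proof.
have c0 m (v : 'I_m -> R) : 0 <= \prod_(j < m) cauchy_fun (v j).
  by apply: prodr_ge0 => j _; exact: ltW (cauchy_fun_gt0 _).
have c2 m (v : 'I_m -> R) : 0 <= \prod_(j < m) (2 * (1 + v j ^+ 2)).
  by apply: prodr_ge0 => j _; rewrite mulr_ge0// addr_ge0// sqr_ge0.
rewrite /heis_prod /shift_bound mulrACA [X in _ <= X * _]mulrACA.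
apply: ler_pM.
- by apply: mulr_ge0; exact: c0.
- exact: ltW (cauchy_fun_gt0 _).
- rewrite /= ; under eq_bigr do rewrite mxE; under [X in _ * X <= _]eq_bigr do rewrite mxE.
  apply: ler_pM; [exact: c0|exact: c0| |]; exact: prod_cauchy_shift.
- exact: cauchy_fun_shift.
Qed.

(** Makes the comparison constant uniform over all steps [h] of size at most 1, as a dominated limit
    in [h] requires. *)
Lemma shift_bound_scale (h : R) (w : heis R n) : `|h| <= 1 ->
  shift_bound (h *: w) <= shift_bound w.
Proof.
move=> h1.
have c2 m (v : 'I_m -> R) : 0 <= \prod_(j < m) (2 * (1 + v j ^+ 2)).
  by apply: prodr_ge0 => j _; rewrite mulr_ge0// addr_ge0// sqr_ge0.
have hs (x : R) : 0 <= 2 * (1 + (h * x) ^+ 2) <= 2 * (1 + x ^+ 2).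
  rewrite mulr_ge0 ?addr_ge0 ?sqr_ge0//= ler_pM2l// lerD2l exprMn.
  by rewrite ler_piMl ?sqr_ge0// -real_normK ?num_real// expr_le1.
have hp m (v : 'I_m -> R) : 
   \prod_(j < m) (2 * (1 + (h * v j) ^+ 2)) <= \prod_(j < m) (2 * (1 + v j ^+ 2)).
  by apply: ler_prod => j _; exact: hs.
rewrite /shift_bound /=; under eq_bigr do rewrite mxE.
under [X in _ * X * _ <= _]eq_bigr do rewrite mxE.
apply: ler_pM.
- by apply: mulr_ge0; exact: c2.
- by case/andP: (hs w.2).
- by apply: ler_pM; [exact: c2|exact: c2|exact: hp|exact: hp].
- by case/andP: (hs w.2).
Qed.

(** Restricting to a line turns directional derivatives into derivatives of one real variable, where
    the mean value theorem is available. *)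
Lemma derivable_line (V : normedModType R) (f : V -> R) (p v : V) (x : R) :
  derivable f (x *: v + p) v ->
  is_derive x 1 (fun h : R => f (h *: v + p)) ('D_v f (x *: v + p)).
Proof.
move=> df.
have E : (fun h : R => h^-1 *: ((f \o shift (x *: v + p)) (h *: v) - f (x *: v + p))) =
  (fun h : R => h^-1 *: (((fun h : R => f (h *: v + p)) \o shift x) (h *: 1) - f (x *: v + p))).
  apply/funext => h /=; have -> : h *: (1 : R) = h by exact: mulr1.
  by rewrite scalerDl addrA.
apply: DeriveDef; first by rewrite /derivable -E.
by rewrite /derive -E.
Qed.

(** By the mean value theorem the increment is [h] times the derivative at some [c *: v + p] with
    [0 < c < h]. The majorant there is [W] at a shifted point, and the shift costs at most
    [shift_bound v], whatever [c] is. *)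
Lemma tame_difference_quotient (f : heis R n -> R) (v : heis R n) :
  (forall p, derivable f p v) ->
  (exists C, forall p, `|'D_v f p| <= C * W p) ->
  exists C, forall (h : R) (p : heis R n), 0 < h <= 1 -> `|f (h *: v + p) - f p| <= h * (C * W p).
Proof.
move=> df [C HC]; exists (C * shift_bound v) => h p /andP[h0 h1].
pose F (x : R) := f (x *: v + p).
have dF (x : R) : is_derive x (1 : R) F ('D_v f (x *: v + p)) by exact: derivable_line.
have cF : {within `[0, h], continuous F}.
  apply: derivable_within_continuous => x _; exact: (ex_derive (is_derive := dF x)).
have [c /[!in_itv]/= /andP[c0 ch]] := @MVT _ F _ 0 h h0 (fun x _ => dF x) cF.
rewrite /F scale0r add0r subr0 => ->.
rewrite normrM mulrC (gtr0_norm h0) ler_pM2l//.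
apply: le_trans (HC _) _.
have C0 : 0 <= C.
  by have := HC p; move/(le_trans (normr_ge0 _)); rewrite pmulr_lge0 ?heis_cauchy_gt0.
rewrite -mulrA ler_wpM2l// addrC; apply: le_trans (heis_cauchy_shift _ _) _.
rewrite ler_pM2r ?heis_cauchy_gt0// shift_bound_scale// gtr0_norm//.
exact: ltW (lt_le_trans ch h1).
Qed.

(* By translation invariance the difference quotients have integral 0. *)
Lemma integral_derive_eq0 (f : heis R n -> R) (v : heis R n) :
  tame f -> (forall p, derivable f p v) -> tame ('D_v f) ->
  Rintegral heis_measure setT ('D_v f) = 0.
Proof.
move=> tf df tDf.
have [C HC] := tame_difference_quotient df tDf.2.
pose h k : R := k.+1%:R^-1.
have h0 k : 0 < h k by rewrite invr_gt0 ltr0n.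
have h1 k : h k <= 1 by rewrite invf_le1 ?ltr0n// ler1n.
pose q k p := (h k)^-1 * (f (h k *: v + p) - f p).
have mf := continuous_measurable_heis tf.1.
have mfs k : measurable_fun setT (fun p => f (h k *: v + p)).
  under eq_fun do rewrite addrC.
  exact: (measurableT_comp mf (measurable_heisD (h k *: v))).
have mq k : measurable_fun setT (fun p => (q k p)%:E).
  apply: measurable_funEFin; apply: measurable_funM => //.
  by apply: measurable_funB => //; exact: mf.
have q_cvg p : (q k p)%:E @[k --> \oo] --> ('D_v f p)%:E.
  apply: cvg_EFin; first exact: nearW.
  have /cvgr_dnbhsP := df p; apply; split; first by move=> k; rewrite gt_eqF.
  exact: (@cvg_harmonic R).
have q_le k p : `|q k p| <= C * W p.
  rewrite normrM normfV (gtr0_norm (h0 k)) ler_pdivrMl//.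
  by apply: HC; rewrite h0 h1.
have iq k : heis_measure.-integrable setT (EFin \o q k).
  apply: (@le_integrable _ _ _ _ setT _ _ (fun p => (C%:E * (EFin \o W) p)%E)) => //.
  - exact: mq.
  - by move=> p _; rewrite /= lee_fin; apply: le_trans (q_le k p) _; exact: ler_norm.
  - exact: integrableZl (integrable_heis_cauchy n).
have mDf := measurable_funEFin (continuous_measurable_heis tDf.1).
have iCW : heis_measure.-integrable setT (fun p => (C%:E * (EFin \o W) p)%E).
  exact: integrableZl (integrable_heis_cauchy n).
have aecvg : {ae heis_measure, forall p : heis R n, setT p ->
    (q k p)%:E @[k --> \oo] --> ('D_v f p)%:E}.
  by apply/aeW => p _; exact: q_cvg.
have aele : {ae heis_measure, forall (p : heis R n) k, setT p ->
    (`|(q k p)%:E| <= C%:E * (EFin \o W) p)%E}.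
  by apply/aeW => p k _; rewrite /= lee_fin.
have [_ _ Hlim] := @dominated_convergence _ _ R heis_measure setT measurableT
  (fun k p => (q k p)%:E) (fun p => ('D_v f p)%:E) (fun p => (C%:E * (EFin \o W) p)%E)
  mq mDf aecvg iCW aele.
have q_int k : (\int[heis_measure]_p (q k p)%:E = 0)%E.
  have if_ := tame_integrable tf.
  (* The translate of [f] is [f] plus [h k] times the quotient; both are already known to be
     integrable. *)
  have ifs : heis_measure.-integrable setT (EFin \o (fun p => f (h k *: v + p))).
    have -> : (EFin \o (fun p => f (h k *: v + p))) = (fun p => (h k)%:E * (q k p)%:E + (f p)%:E)%E.
      apply/funext => p /=; rewrite -EFinM -EFinD /q mulrA mulfV ?gt_eqF// mul1r.
      by rewrite subrK.
    apply: integrableD => //; exact: integrableZl (iq k).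
  under eq_integral do rewrite /q EFinM.
  rewrite integralZl//; last first.
    under eq_fun do rewrite EFinB.
    exact: integrableB.
  under eq_integral do rewrite EFinB.
  rewrite integralB//.
  under eq_integral do rewrite addrC.
  rewrite (integral_heisD (h k *: v) (measurable_funEFin mf)) subee ?mule0//.
  exact: integrable_fin_num.
move: Hlim; under eq_fun do rewrite q_int.
move=> /(cvg_unique _ (cvg_cst _)) => /(_ (@ereal_hausdorff _)) H.
by rewrite /Rintegral -H.
Qed.
End heis_integral.

(** * Functions of class C^k *)

Section Ck_theory.
Context {R : realType} {V : normedModType R}.
Implicit Types (f g : V -> R) (p v : V).

Lemma Ck_continuous k f : Ck k f -> continuous f.
Proof. by case: k => [|k] []. Qed.

Lemma CkS k f : Ck k.+1 f -> Ck k f.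
Proof.
elim: k f => [|k IH] f [cf Hf]; split => // v.
by split; [exact: (Hf v).1|apply: IH; exact: (Hf v).2].
Qed.

Lemma Ck_derivable k f p v : Ck k.+1 f -> derivable f p v.
Proof. by move=> [_ Hf]; exact: (Hf v).1. Qed.

Lemma Ck_derive k f v : Ck k.+1 f -> Ck k (fun p => 'D_v f p).
Proof. by move=> [_ Hf]; exact: (Hf v).2. Qed.

Lemma Ck_cst k (c : R) : Ck k (fun _ : V => c).
Proof.
elim: k c => [|k IH] c; split => //; try (by move=> p; exact: cst_continuous).
move=> v; split; first by move=> p; exact: derivable_cst.
by under [X in Ck _ X]eq_fun do rewrite derive_cst; exact: IH.
Qed.

Lemma CkD k f g : Ck k f -> Ck k g -> Ck k (fun p => f p + g p).
Proof.
elim: k f g => [|k IH] f g kf kg.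
  by split => // p; apply: cvgD; [exact: kf.1|exact: kg.1].
split; first by move=> p; apply: cvgD; [exact: kf.1|exact: kg.1].
move=> v; split; first by move=> p; apply: derivableD; [exact: (kf.2 v).1|exact: (kg.2 v).1].
rewrite (_ : (fun p => 'D_v _ p) = (fun p => 'D_v f p + 'D_v g p)).
  by apply: IH; [exact: (kf.2 v).2|exact: (kg.2 v).2].
by apply/funext => p; apply: deriveD; [exact: (kf.2 v).1|exact: (kg.2 v).1].
Qed.

Lemma CkM k f g : Ck k f -> Ck k g -> Ck k (fun p => f p * g p).
Proof.
elim: k f g => [|k IH] f g kf kg.
  by split => // p; apply: cvgM; [exact: kf.1|exact: kg.1].
split; first by move=> p; apply: cvgM; [exact: kf.1|exact: kg.1].
move=> v; split; first by move=> p; apply: derivableM; [exact: (kf.2 v).1|exact: (kg.2 v).1].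
rewrite (_ : (fun p => 'D_v _ p) = (fun p => f p * 'D_v g p + g p * 'D_v f p)).
  apply: CkD; apply: IH; [exact: CkS kf|exact: (kg.2 v).2|exact: CkS kg|exact: (kf.2 v).2].
apply/funext => p; rewrite (_ : (fun p => f p * g p) = f * g)//.
by rewrite deriveM; [|exact: (kf.2 v).1|exact: (kg.2 v).1].
Qed.

Lemma CkN k f : Ck k f -> Ck k (fun p => - f p).
Proof.
move=> kf; rewrite (_ : (fun p => - f p) = (fun p => (-1) * f p)).
  by apply: CkM => //; exact: Ck_cst.
by apply/funext => p; rewrite mulN1r.
Qed.

Lemma CkB k f g : Ck k f -> Ck k g -> Ck k (fun p => f p - g p).
Proof. by move=> kf kg; apply: CkD => //; exact: CkN. Qed.

Lemma is_derive_linear f p v : linear f -> is_derive p v f (f v).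
Proof.
move=> lf.
have fD x y : f (x + y) = f x + f y by have := lf 1 x y; rewrite !scale1r.
have f0 : f 0 = 0 by have := fD 0 0; rewrite addr0 => /eqP; rewrite -subr_eq0 opprD addNKr oppr_eq0 => /eqP.
have fZ (a : R) x : f (a *: x) = a * f x by have := lf a x 0; rewrite !addr0 f0 addr0.
have H : h^-1 *: ((f \o shift p) (h *: v) - f p) @[h --> 0^'] --> f v.
  apply: (@cvg_trans _ (f v @[h --> (0:R)^'])); last exact: cvg_cst.
  apply: near_eq_cvg; near=> h.
  rewrite /= fD addrK fZ /GRing.scale /= mulKf//.
  by near: h; exact: nbhs_dnbhs_neq.
apply: DeriveDef; first by apply/cvg_ex; exists (f v).
exact/cvg_lim.
Unshelve. all: by end_near. Qed.

(** The derivative along [v] is the constant [f v]. Continuity is a separate hypothesis because [V]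
    may be infinite-dimensional. *)
Lemma Ck_linear k f : linear f -> continuous f -> Ck k f.
Proof.
move=> lf cf; case: k => [|k]; split => // v.
have D p := is_derive_linear p v lf.
split; first by move=> p; exact: (ex_derive (is_derive := D p)).
rewrite (_ : (fun p => 'D_v f p) = (fun=> f v)); first exact: Ck_cst.
by apply/funext => p; exact: (derive_val (is_derive := D p)).
Qed.

Lemma compact_support_bounded f :
  continuous f -> compact (closure [set p | f p != 0]) ->
  exists C, 0 <= C /\ forall p, `|f p| <= C.
Proof.
move=> cf cK.
have cn : {within closure [set p | f p != 0], continuous (fun p => `|f p|)}.
  by apply: continuous_subspaceT => p; apply: (cvg_comp _ _ (cf p)); exact: norm_continuous.
have [K0|/set0P K0] := eqVneq (closure [set p | f p != 0]) set0.
  exists 0; split => // p; rewrite normr_le0; apply/eqP; apply: contrapT => /eqP fp.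
  by have : closure [set p | f p != 0] p by [exact: subset_closure]; rewrite K0.
have [c _ Hc] := compact_EVT_max K0 cK cn.
exists `|f c|; split => // p.
have [->|fp] := eqVneq (f p) 0; first by rewrite normr0.
by apply: Hc; rewrite inE; exact: subset_closure.
Qed.

Lemma notin_closure_near (A : set V) p : ~ closure A p -> \forall q \near p, ~ A q.
Proof.
move=> np; have oC : open (~` closure A) by apply: closed_openC; exact: closed_closure.
have : nbhs p (~` closure A) by apply: open_nbhs_nbhs; split.
by apply: filterS => q nq Aq; apply: nq; exact: subset_closure.
Qed.

(** Off the closed support the function vanishes on a neighbourhood, hence so does its derivative at
    the point; closing up again adds nothing. *)
Lemma derive_support f v :
  closure [set p | 'D_v f p != 0] `<=` closure [set p | f p != 0].
Proof.
have -> : closure [set p | f p != 0] = closure (closure [set p | f p != 0]).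
  exact/closure_id/closed_closure.
apply: closure_subset => p /=; apply: contra_neqP => /notin_closure_near H.
rewrite -(derive_cst (0 : R) p v); apply: near_eq_derive => //.
by apply: filterS H => q /= /negP; rewrite negbK => /eqP.
Qed.

End Ck_theory.

(** * Compactly supported functions *)

Section tame_support.
Context {R : realType} {n : nat}.
Local Notation W := (@heis_prod R n cauchy_fun).

Lemma continuous_heis_x (j : 'I_n) : continuous (fun p : heis R n => p.1.1 ord0 j).
Proof.
move=> p; apply: (@continuous_comp _ _ _ (fun p : heis R n => p.1.1) (fun v => v ord0 j)).
  by apply: (@continuous_comp _ _ _ fst fst); exact: cvg_fst.
exact: coord_continuous.
Qed.

Lemma continuous_heis_y (j : 'I_n) : continuous (fun p : heis R n => p.1.2 ord0 j).
Proof.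
move=> p; apply: (@continuous_comp _ _ _ (fun p : heis R n => p.1.2) (fun v => v ord0 j)).
  by apply: (@continuous_comp _ _ _ fst snd); [exact: cvg_fst|exact: cvg_snd].
exact: coord_continuous.
Qed.

Lemma continuous_heis_t : continuous (fun p : heis R n => p.2).
Proof. by move=> p; exact: cvg_snd. Qed.

Lemma continuous_prod_fun (I : Type) (T : topologicalType) (r : seq I) (F : I -> T -> R) :
  (forall i, continuous (F i)) -> continuous (fun x => \prod_(i <- r) F i x).
Proof.
move=> cF x; elim: r => [|i r IH].
  by under eq_fun do rewrite big_nil; exact: cst_continuous.
under eq_fun do rewrite big_cons.
by apply: cvgM; [exact: cF|exact: IH].
Qed.

Lemma continuous_heis_prod (g : R -> R) : continuous g -> continuous (@heis_prod R n g).
Proof.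
move=> cg p; apply: cvgM; first apply: cvgM.
- apply: (@continuous_prod_fun _ _ _ (fun j (p : heis R n) => g (p.1.1 ord0 j))) => j q.
  by apply: (@continuous_comp _ _ _ _ g); [exact: continuous_heis_x|exact: cg].
- apply: (@continuous_prod_fun _ _ _ (fun j (p : heis R n) => g (p.1.2 ord0 j))) => j q.
  by apply: (@continuous_comp _ _ _ _ g); [exact: continuous_heis_y|exact: cg].
- by apply: (@continuous_comp _ _ _ _ g); [exact: continuous_heis_t|exact: cg].
Qed.

(** [W] is continuous and positive, so [f / W] is continuous with compact support and therefore
    bounded; its bound is the required constant. *)
Lemma tame_compact_support (f : heis R n -> R) :
  continuous f -> compact (closure [set p | f p != 0]) -> tame f.
Proof.
move=> cf cK; split => //.
have W0 p : W p != 0 by rewrite gt_eqF// heis_cauchy_gt0.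
have [||C [C0 HC]] := @compact_support_bounded R _ (fun p => f p * (W p)^-1).
- move=> p; apply: cvgM; first exact: cf.
  by apply: cvgV => //; exact: continuous_heis_prod (@continuous_oneDsqrV R) p.
- apply: (subclosed_compact _ cK); first exact: closed_closure.
  by apply: closure_subset => p /=; apply: contra_neq => ->; rewrite mul0r.
exists C => p; have := HC p.
by rewrite normrM normfV (gtr0_norm (heis_cauchy_gt0 p)) ler_pdivrMr ?heis_cauchy_gt0.
Qed.

Lemma integral_derive_compact_support (f : heis R n -> R) v :
  Ck 1 f -> compact (closure [set p | f p != 0]) ->
  Rintegral heis_measure setT ('D_v f) = 0.
Proof.
move=> kf cK; apply: integral_derive_eq0.
- apply: tame_compact_support => //; exact: Ck_continuous kf.
- by move=> p; exact: Ck_derivable kf.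
- apply: tame_compact_support; first exact: (Ck_continuous (Ck_derive _ kf)).
  apply: (subclosed_compact _ cK); first exact: closed_closure.
  exact: derive_support.
Qed.

End tame_support.

(** * Complex-valued functions *)

Local Notation Re := complex.Re.
Local Notation Im := complex.Im.

Section complex_arith.
Context {R : realType}.
Implicit Types x y : R[i].

Lemma complex_ext x y : Re x = Re y -> Im x = Im y -> x = y.
Proof. by case: x y => [a b] [c d] /= -> ->. Qed.

Lemma complexReM x y : Re (x * y) = Re x * Re y - Im x * Im y.
Proof. by case: x y => [a b] [c d]. Qed.

Lemma complexImM x y : Im (x * y) = Re x * Im y + Im x * Re y.
Proof. by case: x y => [a b] [c d]. Qed.

Lemma complexReD x y : Re (x + y) = Re x + Re y.
Proof. by case: x y => [a b] [c d]. Qed.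

Lemma complexImD x y : Im (x + y) = Im x + Im y.
Proof. by case: x y => [a b] [c d]. Qed.

Lemma complexReN x : Re (- x) = - Re x.
Proof. by case: x. Qed.

Lemma complexImN x : Im (- x) = - Im x.
Proof. by case: x. Qed.

Definition complexReIm := (complexReD, complexImD, complexReN, complexImN, complexReM, complexImM).

Lemma normc_ge0 x : 0 <= normc x.
Proof. by case: x => a b; exact: sqrtr_ge0. Qed.

Lemma sqr_normc_ReIm x : normc x ^+ 2 = Re x ^+ 2 + Im x ^+ 2.
Proof. by case: x => a b; rewrite /= sqr_sqrtr// addr_ge0// sqr_ge0. Qed.

Lemma normc_Re x : `|Re x| <= normc x.
Proof.
by rewrite -(ler_pXn2r (n := 2)) ?nnegrE ?normc_ge0// real_normK ?num_real// sqr_normc_ReIm lerDl sqr_ge0.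
Qed.

Lemma normc_Im x : `|Im x| <= normc x.
Proof.
by rewrite -(ler_pXn2r (n := 2)) ?nnegrE ?normc_ge0// real_normK ?num_real// sqr_normc_ReIm lerDr sqr_ge0.
Qed.

Lemma normc_le x : normc x <= `|Re x| + `|Im x|.
Proof.
rewrite -(ler_pXn2r (n := 2)) ?nnegrE ?normc_ge0 ?addr_ge0// sqr_normc_ReIm sqrrD.
rewrite !real_normK ?num_real// addrAC lerDl.
by rewrite mulrn_wge0// mulr_ge0.
Qed.

Lemma normc_real (a : R) : normc (a%:C)%C = `|a|.
Proof. by rewrite /= expr0n/= addr0 sqrtr_sqr. Qed.

Lemma normcX x k : normc (x ^+ k) = normc x ^+ k.
Proof.
elim: k => [|k IH]; first by rewrite !expr0; exact: ComplexField.Normc.normc1.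
by rewrite !exprS ComplexField.Normc.normcM IH.
Qed.

(** Cauchy-Schwarz in the plane, from the identity of Lagrange: the defect is the square of the
    determinant. *)
Lemma ReM_le x y : Re x * Re y + Im x * Im y <= normc x * normc y.
Proof.
have [h|h] := ltP (Re x * Re y + Im x * Im y) 0.
  by rewrite (le_trans (ltW h))// mulr_ge0 ?normc_ge0.
rewrite -(ler_pXn2r (n := 2)) ?nnegrE ?mulr_ge0 ?normc_ge0// exprMn !sqr_normc_ReIm.
rewrite -subr_ge0.
have -> : (Re x ^+ 2 + Im x ^+ 2) * (Re y ^+ 2 + Im y ^+ 2) - (Re x * Re y + Im x * Im y) ^+ 2 =
  (Re x * Im y - Im x * Re y) ^+ 2 by ring.
exact: sqr_ge0.
Qed.

Lemma cexpD x y : cexp (x + y) = cexp x * cexp y.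
Proof.
apply: complex_ext; rewrite /cexp !complexReIm /= ?mul0r ?subr0 ?addr0 expRD ?cosD ?sinD; ring.
Qed.

Lemma Re_cexp x : Re (cexp x) = expR (Re x) * cos (Im x).
Proof. by rewrite /cexp complexReIm /= mul0r subr0. Qed.

Lemma Im_cexp x : Im (cexp x) = expR (Re x) * sin (Im x).
Proof. by rewrite /cexp complexReIm /= mul0r addr0. Qed.

Lemma normc_cexp x : normc (cexp x) = expR (Re x).
Proof.
apply: (@pexpIrn R 2) => //; rewrite ?nnegrE ?normc_ge0 ?expR_ge0//.
by rewrite sqr_normc_ReIm Re_cexp Im_cexp !exprMn -mulrDr cos2Dsin2 mulr1.
Qed.

End complex_arith.

Section is_derive_fun.
Context {R : realType} {V : normedModType R}.
Implicit Types (f g : V -> R) (p v : V).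

Lemma is_derive_funC (c : R) p v : is_derive p v (fun=> c) (0 : R).
Proof. exact: is_derive_cst. Qed.

Lemma is_derive_funD f g p v (df dg : R) : is_derive p v f df -> is_derive p v g dg ->
  is_derive p v (fun x => f x + g x) (df + dg).
Proof. exact: is_deriveD. Qed.

Lemma is_derive_funB f g p v (df dg : R) : is_derive p v f df -> is_derive p v g dg ->
  is_derive p v (fun x => f x - g x) (df - dg).
Proof. exact: is_deriveB. Qed.

Lemma is_derive_funM f g p v (df dg : R) : is_derive p v f df -> is_derive p v g dg ->
  is_derive p v (fun x => f x * g x) (df * g p + f p * dg).
Proof.
move=> df' dg'; rewrite (_ : (fun x => f x * g x) = f * g)//.
apply: (is_derive_eq (is_deriveM df' dg')).
by rewrite addrC /GRing.scale /= [X in X + _ = _]mulrC.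
Qed.

End is_derive_fun.

Section complex_derive.
Context {R : realType} {V : normedModType R}.
Implicit Types (f g : V -> R[i]) (p v : V).

(** Joins existence and value of the derivative in one relation, so that the rules of calculus
    compose without separate derivability side conditions. *)
Definition cis_derive f p v (d : R[i]) : Prop :=
  is_derive p v (fun q => Re (f q)) (Re d) /\ is_derive p v (fun q => Im (f q)) (Im d).

Lemma cderivableP f p v : cderivable f p v -> cis_derive f p v (cderive f p v).
Proof. by move=> [h1 h2]; split; exact: derivableP. Qed.

Lemma cis_derivable f p v d : cis_derive f p v d -> cderivable f p v.
Proof. by move=> [[? _] [? _]]; split. Qed.

Lemma cis_derive_val f p v d : cis_derive f p v d -> cderive f p v = d.
Proof. by move=> [[_ h1] [_ h2]]; apply: complex_ext. Qed.

Lemma cis_derive_cst (c : R[i]) p v : cis_derive (fun=> c) p v 0.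
Proof. by split; exact: is_derive_cst. Qed.

Lemma cis_derive_real (f : V -> R) p v d : is_derive p v f d ->
  cis_derive (fun q => (f q)%:C%C) p v (d%:C%C).
Proof. by move=> df; split => //=; exact: is_derive_cst. Qed.

Lemma cis_deriveD f g p v df dg : cis_derive f p v df -> cis_derive g p v dg ->
  cis_derive (fun q => f q + g q) p v (df + dg).
Proof.
move=> [f1 f2] [g1 g2]; split; rewrite complexReIm.
  by under eq_fun do rewrite complexReIm; exact: is_deriveD.
by under eq_fun do rewrite complexReIm; exact: is_deriveD.
Qed.

Lemma cis_deriveN f p v df : cis_derive f p v df ->
  cis_derive (fun q => - f q) p v (- df).
Proof.
move=> [f1 f2]; split; rewrite complexReIm.
  by under eq_fun do rewrite complexReIm; exact: is_deriveN.
by under eq_fun do rewrite complexReIm; exact: is_deriveN.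
Qed.

Lemma cis_deriveM f g p v df dg : cis_derive f p v df -> cis_derive g p v dg ->
  cis_derive (fun q => f q * g q) p v (df * g p + f p * dg).
Proof.
move=> [f1 f2] [g1 g2]; split; rewrite !complexReIm.
  under eq_fun do rewrite complexReIm.
  apply: (is_derive_eq (is_derive_funB (is_derive_funM f1 g1) (is_derive_funM f2 g2))).
  ring.
under eq_fun do rewrite complexReIm.
apply: (is_derive_eq (is_derive_funD (is_derive_funM f1 g2) (is_derive_funM f2 g1))).
ring.
Qed.

Lemma cis_derive_eq f p v d d' : cis_derive f p v d -> d = d' -> cis_derive f p v d'.
Proof. by move=> ? <-. Qed.

Lemma cCk_cderivable k f p v : cCk k.+1 f -> cderivable f p v.
Proof. by move=> [h1 h2]; split; [exact: Ck_derivable h1|exact: Ck_derivable h2]. Qed.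

Lemma cCk_cderive k f v : cCk k.+1 f -> cCk k (fun p => cderive f p v).
Proof. by move=> [h1 h2]; split; [exact: (Ck_derive v h1)|exact: (Ck_derive v h2)]. Qed.

Lemma cCk_cst k (c : R[i]) : cCk k (fun _ : V => c).
Proof. by split; exact: Ck_cst. Qed.

Lemma cCk_real k (f : V -> R) : Ck k f -> cCk k (fun p => (f p)%:C%C).
Proof. by move=> kf; split => //=; exact: Ck_cst. Qed.

Lemma cCkD k f g : cCk k f -> cCk k g -> cCk k (fun p => f p + g p).
Proof.
move=> [f1 f2] [g1 g2]; split; under eq_fun do rewrite complexReIm; exact: CkD.
Qed.

Lemma cCkN k f : cCk k f -> cCk k (fun p => - f p).
Proof.
move=> [f1 f2]; split; under eq_fun do rewrite complexReIm; exact: CkN.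
Qed.

Lemma cCkM k f g : cCk k f -> cCk k g -> cCk k (fun p => f p * g p).
Proof.
move=> [f1 f2] [g1 g2]; split; under eq_fun do rewrite complexReIm.
- by apply: CkB; exact: CkM.
- by apply: CkD; exact: CkM.
Qed.

Lemma cCkS k f : cCk k.+1 f -> cCk k f.
Proof. by move=> [h1 h2]; split; exact: CkS. Qed.

(** Both difference quotients are the same function of the increment. This is the way back from a
    computation along a line to a derivative on [V]. *)
Lemma is_derive_of_line (f : V -> R) p v d :
  is_derive (0 : R) (1 : R) (fun h : R => f (h *: v + p)) d -> is_derive p v f d.
Proof.
move=> [h1 h2].
have E : (fun h : R => h^-1 *: ((f \o shift p) (h *: v) - f p)) =
  (fun h : R => h^-1 *: (((fun h : R => f (h *: v + p)) \o shift 0) (h *: 1) - f (0 *: v + p))).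
  apply/funext => h /=; have -> : h *: (1 : R) = h by exact: mulr1.
  by rewrite addr0 scale0r add0r.
apply: DeriveDef; first by rewrite /derivable E.
by rewrite /derive E.
Qed.

End complex_derive.

Section complex_derive_R.
Context {R : realType}.

Lemma cis_derive_of_line (V : normedModType R) (f : V -> R[i]) p v d :
  cis_derive (fun h : R => f (h *: v + p)) 0 1 d -> cis_derive f p v d.
Proof. by move=> [h1 h2]; split; exact: is_derive_of_line. Qed.

Lemma cis_derive_cexp (w : R -> R[i]) (x : R) d :
  cis_derive w x 1 d -> cis_derive (fun h => cexp (w h)) x 1 (d * cexp (w x)).
Proof.
move=> [w1 w2]; split; rewrite complexReIm Re_cexp Im_cexp.
- under eq_fun do rewrite Re_cexp.
  apply: (is_derive_eq (is_derive_funM (is_derive1_comp (is_derive_expR _) w1) (is_derive1_comp (is_derive_cos _) w2))).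
  by rewrite /=; ring.
- under eq_fun do rewrite Im_cexp.
  apply: (is_derive_eq (is_derive_funM (is_derive1_comp (is_derive_expR _) w1) (is_derive1_comp (is_derive_sin _) w2))).
  by rewrite /=; ring.
Qed.

End complex_derive_R.

(** * Integrals of complex-valued functions *)

Section complex_integral.
Context {R : realType} d {T : measurableType d} {mu : {measure set T -> \bar R}}.
Implicit Types f g : T -> R[i].

Definition cintegrable f : Prop :=
  mu.-integrable setT (fun x => (Re (f x))%:E) /\ mu.-integrable setT (fun x => (Im (f x))%:E).

Lemma cintegrableZ (c : R[i]) f : cintegrable f -> cintegrable (fun x => c * f x).
Proof.
move=> [f1 f2]; split; under eq_fun do rewrite complexReIm ?EFinB ?EFinD !EFinM.
- by apply: integrableB => //; exact: integrableZl.
- by apply: integrableD => //; exact: integrableZl.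
Qed.

Lemma integrable_scale (c : R) (f : T -> R) : mu.-integrable setT (EFin \o f) ->
  mu.-integrable setT (EFin \o (fun x => c * f x)).
Proof.
by move=> mf; rewrite /comp; under eq_fun do rewrite EFinM; exact: integrableZl.
Qed.

Lemma cintegralD f g : cintegrable f -> cintegrable g ->
  cintegral mu (fun x => f x + g x) = cintegral mu f + cintegral mu g.
Proof.
move=> [f1 f2] [g1 g2]; apply: complex_ext; rewrite complexReIm /=.
- by under eq_Rintegral do rewrite complexReIm; rewrite RintegralD.
- by under eq_Rintegral do rewrite complexReIm; rewrite RintegralD.
Qed.

Lemma cintegralZ (c : R[i]) f : cintegrable f ->
  cintegral mu (fun x => c * f x) = c * cintegral mu f.
Proof.
move=> [f1 f2]; apply: complex_ext; rewrite complexReIm /=.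
- under eq_Rintegral do rewrite complexReIm.
  by rewrite RintegralB// ?RintegralZl//; exact: integrable_scale.
- under eq_Rintegral do rewrite complexReIm.
  by rewrite RintegralD// ?RintegralZl//; exact: integrable_scale.
Qed.

Lemma measurable_normc f : cmeasurable f -> measurable_fun setT (fun x => normc (f x)).
Proof.
move=> [m1 m2].
rewrite (_ : (fun x => normc (f x)) = (fun x => Num.sqrt (Re (f x) ^+ 2 + Im (f x) ^+ 2))).
  apply: (measurableT_comp (continuous_measurable_fun (@sqrt_continuous R))).
  by apply: measurable_funD; apply: measurable_funX.
by apply/funext => x; case: (f x).
Qed.

Lemma cintegrable_measurable f : cintegrable f -> cmeasurable f.
Proof.
by move=> [/measurable_int/measurable_EFinP f1 /measurable_int/measurable_EFinP f2].
Qed.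

Lemma cintegrable_normc f : cintegrable f -> mu.-integrable setT (fun x => (normc (f x))%:E).
Proof.
move=> cf; have [f1 f2] := cf.
apply: (@le_integrable _ _ _ _ setT _ _ (fun x => (`|Re (f x)| + `|Im (f x)|)%:E)) => //.
- apply: measurable_funEFin; exact: measurable_normc (cintegrable_measurable cf).
- move=> x _; rewrite /= lee_fin ger0_norm ?normc_ge0// ger0_norm ?addr_ge0//.
  exact: normc_le.
- by under eq_fun do rewrite EFinD; apply: integrableD => //; [exact: (integrable_abse f1)|exact: (integrable_abse f2)].
Qed.

(** With [I] the integral, |I|^2 = Re I Re I + Im I Im I is the integral of Re I Re f + Im I Im f,
    which is at most |I| |f| pointwise; then divide by |I|, the case I = 0 being trivial. *)
Lemma normc_cintegral_le f : cintegrable f ->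
  normc (cintegral mu f) <= Rintegral mu setT (fun x => normc (f x)).
Proof.
move=> cf; have [f1 f2] := cf.
set I := cintegral mu f; have := normc_ge0 I; rewrite le_eqVlt => /predU1P[<-|I0].
  by apply: Rintegral_ge0 => x _; exact: normc_ge0.
rewrite -(ler_pM2l I0) -expr2 sqr_normc_ReIm.
have i1 c : mu.-integrable setT (EFin \o (fun x => c * Re (f x))).
  exact: integrable_scale.
have i2 c : mu.-integrable setT (EFin \o (fun x => c * Im (f x))).
  exact: integrable_scale.
rewrite !expr2 [X in Re I * X]/= [X in Im I * X]/= -!RintegralZl//; last exact: cintegrable_normc.
rewrite -RintegralD//; apply: le_Rintegral => //.
- by rewrite /comp; under eq_fun do rewrite EFinD; apply: integrableD => //; [exact: i1|exact: i2].
- exact: integrable_scale (cintegrable_normc cf).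
- by move=> x _; exact: ReM_le.
Qed.

End complex_integral.
Arguments cintegrable {R d T} mu f.

(** * Smoothness on the real line *)

Section smooth_R.
Context {R : realType}.
Implicit Types f : R -> R.

(** [Ck] quantifies over all directions, also on the line, whereas [nderiv] only uses the direction
    1. *)
Lemma is_derive_dir f (x v d : R) : is_derive x 1 f d -> is_derive x v f (v * d).
Proof.
move=> [h1 h2]; have df : differentiable f x by exact/derivable1_diffP.
apply: DeriveDef; first exact: diff_derivable.
rewrite deriveE// -[in LHS](mulr1 v) -[_ * 1]/(v *: (1 : R)) linearZ /= -deriveE// h2.
by [].
Qed.

(** No continuity has to be assumed: each derivative is itself derivable, hence continuous. *)
Lemma derivable_Ck f :
  (forall j x, derivable (iter j (fun g : R -> R => fun x : R => 'D_(1 : R) g x) f) x (1 : R)) ->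
  forall k, Ck k f.
Proof.
move=> df k; elim: k f df => [|k IH] f df.
  split => // x; apply: differentiable_continuous; apply/derivable1_diffP; exact: (df 0%N).
split; first by move=> x; apply: differentiable_continuous; apply/derivable1_diffP; exact: (df 0%N).
move=> v.
have D x : is_derive x v f (v * 'D_1 f x).
  apply: is_derive_dir; apply: derivableP; exact: (df 0%N).
split; first by move=> x; exact: (ex_derive (is_derive := D x)).
rewrite (_ : (fun p => 'D_v f p) = (fun p => v * 'D_1 f p)).
  apply: CkM; first exact: Ck_cst.
  by apply: IH => j x; have := df j.+1 x; rewrite iterSr.
by apply/funext => x; exact: (derive_val (is_derive := D x)).
Qed.

Lemma Re_nderiv k (phi : R -> R[i]) :
  (fun x => Re (nderiv k phi x)) =
  iter k (fun g : R -> R => fun x : R => 'D_(1 : R) g x) (fun x => Re (phi x)).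
Proof. by elim: k => [//|k IH]; rewrite [RHS]iterS -IH. Qed.

Lemma Im_nderiv k (phi : R -> R[i]) :
  (fun x => Im (nderiv k phi x)) =
  iter k (fun g : R -> R => fun x : R => 'D_(1 : R) g x) (fun x => Im (phi x)).
Proof. by elim: k => [//|k IH]; rewrite [RHS]iterS -IH. Qed.

Lemma cderivable_cCk (phi : R -> R[i]) :
  (forall k (x : R), cderivable (nderiv k phi) x (1 : R)) -> forall k, cCk k phi.
Proof.
move=> H k; split; apply: derivable_Ck => j x.
- by rewrite -Re_nderiv; have [] := H j x.
- by rewrite -Im_nderiv; have [] := H j x.
Qed.

End smooth_R.

(** * Superpositions of exponentials *)

Section wave.
Context {R : realType}.
Local Notation leb := (@lebesgue_measure R).
Variable alpha : R.
Hypothesis alpha_gt0 : 0 < alpha.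
Implicit Types (phi : R -> R[i]) (w : R[i]).

Definition supported phi := forall l, ~~ (alpha <= l <= alpha + 1) -> phi l = 0.

Lemma integrable_supported (f : R -> R) : continuous f ->
  (forall l, ~~ (alpha <= l <= alpha + 1) -> f l = 0) ->
  leb.-integrable setT (EFin \o f).
Proof.
move=> cf f0.
have := @continuous_compact_integrable R f `[alpha, alpha + 1] (@segment_compact _ _ _)
  (continuous_subspaceT cf).
rewrite integrable_mkcond//; congr (leb.-integrable _ _).
apply/funext => l; rewrite patchE; case: ifPn => // /negP lN.
by rewrite /= f0//; apply/negP => h; apply: lN; rewrite inE /= in_itv.
Qed.

Lemma cintegrable_supported phi : cCk 0 phi -> supported phi -> cintegrable leb phi.
Proof.
move=> [[c1 _] [c2 _]] s; split; apply: integrable_supported => // l /s ->//.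
Qed.

Lemma cCk0_cexp (V : normedModType R) (w : V -> R[i]) : cCk 0 w -> cCk 0 (fun p => cexp (w p)).
Proof.
move=> [[c1 _] [c2 _]]; split; split => // p.
- under eq_fun do rewrite Re_cexp; apply: cvgM.
    exact: (@continuous_comp _ _ _ (fun p => Re (w p)) expR p (c1 p) (@continuous_expR R _)).
  exact: (@continuous_comp _ _ _ (fun p => Im (w p)) cos p (c2 p) (@continuous_cos R _)).
- under eq_fun do rewrite Im_cexp; apply: cvgM.
    exact: (@continuous_comp _ _ _ (fun p => Re (w p)) expR p (c1 p) (@continuous_expR R _)).
  exact: (@continuous_comp _ _ _ (fun p => Im (w p)) sin p (c2 p) (@continuous_sin R _)).
Qed.

Lemma Ck_id k : Ck k (fun x : R => x).
Proof. by apply: Ck_linear => //; move=> x; exact: cvg_id. Qed.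

Lemma cCk_id k : cCk k (fun x : R => x%:C%C).
Proof. by apply: cCk_real; exact: Ck_id. Qed.

(** The Laplace transform of [phi], written with the exponent [+ l w]. The absolute value on the
    frequency is absent since only positive [l] matter. *)
Definition wave phi w : R[i] := cintegral leb (fun l : R => cexp (l%:C%C * w) * phi l).

Lemma wave_cCk0 phi w : cCk 0 phi -> cCk 0 (fun l : R => cexp (l%:C%C * w) * phi l).
Proof.
move=> cp; apply: cCkM => //; apply: cCk0_cexp; apply: cCkM; first exact: cCk_id.
exact: cCk_cst.
Qed.

Lemma supportedMl (f phi : R -> R[i]) : supported phi -> supported (fun l => f l * phi l).
Proof. by move=> s l /s ->; rewrite mulr0. Qed.

Lemma wave_integrable phi w : cCk 0 phi -> supported phi ->
  cintegrable leb (fun l : R => cexp (l%:C%C * w) * phi l).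
Proof.
move=> cp sp; apply: cintegrable_supported; first exact: wave_cCk0.
exact: supportedMl.
Qed.

(** The effect on the profile of differentiating [wave phi w] in [w]. *)
Definition lmul phi : R -> R[i] := fun l => l%:C%C * phi l.

Lemma lmul_cCk k phi : cCk k phi -> cCk k (lmul phi).
Proof. by move=> cp; apply: cCkM => //; exact: cCk_id. Qed.

Lemma lmul_supported phi : supported phi -> supported (lmul phi).
Proof. exact: supportedMl. Qed.

Lemma normc_wave_integrand phi w l : supported phi -> Re w <= 0 ->
  normc (cexp (l%:C%C * w) * phi l) <= expR (alpha * Re w) * normc (phi l).
Proof.
move=> sp w0; rewrite ComplexField.Normc.normcM normc_cexp complexReIm /= mul0r subr0.
have [/andP[al _]|/sp ->] := boolP (alpha <= l <= alpha + 1).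
  by rewrite ler_wpM2r ?normc_ge0// ler_expR ler_wnM2r.
by rewrite ComplexField.Normc.normc0 !mulr0.
Qed.

(** The real-valued form of [L1norm]; the two are identified by [L1normE]. *)
Definition mass phi : R := Rintegral leb setT (fun l => normc (phi l)).

Lemma mass_ge0 phi : 0 <= mass phi.
Proof. by apply: Rintegral_ge0 => l _; exact: normc_ge0. Qed.

Lemma L1normE phi : cCk 0 phi -> supported phi -> L1norm phi = (mass phi)%:E.
Proof.
move=> cp sp; rewrite /L1norm Lnorm1 /mass /Rintegral.
have ip := cintegrable_normc (cintegrable_supported cp sp).
rewrite fineK; last exact: integrable_fin_num.
by apply: eq_integral => l _; rewrite /= ger0_norm// normc_ge0.
Qed.

Lemma normc_wave phi w : cCk 0 phi -> supported phi -> Re w <= 0 ->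
  normc (wave phi w) <= expR (alpha * Re w) * mass phi.
Proof.
move=> cp sp w0; have iw := wave_integrable w cp sp.
apply: le_trans (normc_cintegral_le iw) _.
have ip := cintegrable_normc (cintegrable_supported cp sp).
rewrite /mass -RintegralZl//; apply: le_Rintegral => //.
- exact: cintegrable_normc.
- exact: integrable_scale.
- by move=> l _; exact: normc_wave_integrand.
Qed.

Lemma integral_derive_supported (g g' : R -> R) :
  (forall x, is_derive x (1 : R) g (g' x)) -> continuous g' ->
  (forall l, ~~ (alpha <= l <= alpha + 1) -> g l = 0) ->
  (forall l, ~~ (alpha <= l <= alpha + 1) -> g' l = 0) ->
  Rintegral leb setT g' = 0.
Proof.
move=> dg cg' g0 g'0.
have cg : continuous g.
  move=> x; apply: differentiable_continuous; apply/derivable1_diffP.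
  exact: (ex_derive (is_derive := dg x)).
(* The margin of one unit on each side puts the endpoints strictly outside [[alpha, alpha + 1]],
   where [g] is known to vanish. *)
transitivity (Rintegral leb `[alpha - 1, alpha + 2] g').
  rewrite [RHS]Rintegral_mkcond; apply: eq_Rintegral => l _; rewrite patchE.
  case: ifPn => // /negP lN; apply: g'0; apply/negP => /andP[h1 h2]; apply: lN.
  by rewrite inE /= in_itv/=; apply/andP; split; lra.
rewrite /Rintegral (@continuous_FTC2 R g' g).
- by rewrite (g0 (alpha + 2)) ?(g0 (alpha - 1)) ?subee//; apply/negP => /andP[h1 h2]; lra.
- lra.
- exact: continuous_subspaceT.
- split.
  + by move=> x _; exact: (ex_derive (is_derive := dg x)).
  + by apply: cvg_at_right_filter; exact: cg.
  + by apply: cvg_at_left_filter; exact: cg.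
- by move=> x _; rewrite derive1E; exact: (derive_val (is_derive := dg x)).
Qed.

(** The complement of the closed interval is open, so [phi] vanishes near each of its points. *)
Lemma cderive_supported phi : supported phi -> supported (fun x => cderive phi x (1 : R)).
Proof.
move=> sp l lN.
have : \forall q \near l, phi q = 0.
  have oC : open (~` `[alpha, alpha + 1]%classic) by apply: closed_openC; exact: itv_closed.
  have : nbhs l (~` `[alpha, alpha + 1]%classic).
    apply: open_nbhs_nbhs; split => //; rewrite /= in_itv/=; exact/negP.
  by apply: filterS => q /=; rewrite in_itv/= => /negP; exact: sp.
move=> nz; apply: complex_ext => /=.
- rewrite -(derive_cst (0 : R) l 1); apply: near_eq_derive => //.
  by apply: filterS nz => q /= ->.
- rewrite -(derive_cst (0 : R) l 1); apply: near_eq_derive => //.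
  by apply: filterS nz => q /= ->.
Qed.

Lemma wave_by_parts phi w : cCk 1 phi -> supported phi ->
  w * wave phi w = - wave (fun x => cderive phi x (1 : R)) w.
Proof.
move=> cp sp.
have cp0 := cCkS cp.
have cp' := cCk_cderive (1 : R) cp.
have sp' := cderive_supported sp.
have iw := wave_integrable w cp0 sp.
have iw' := wave_integrable w cp' sp'.
apply/eqP; rewrite -addr_eq0; apply/eqP.
rewrite -cintegralZ// -cintegralD//; last exact: cintegrableZ.
have D (l : R) : cis_derive (fun l : R => cexp (l%:C%C * w) * phi l) l (1 : R)
    (w * (cexp (l%:C%C * w) * phi l) + cexp (l%:C%C * w) * cderive phi l (1 : R)).
  apply: cis_derive_eq.
    apply: (@cis_deriveM _ _ (fun l : R => cexp (l%:C%C * w)) phi); last first.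
      exact: (cderivableP (cCk_cderivable _ _ cp)).
    apply: (@cis_derive_cexp _ (fun l : R => l%:C%C * w)).
    apply: (@cis_deriveM _ _ (fun l : R => l%:C%C) (fun=> w)); last exact: cis_derive_cst.
    by apply: cis_derive_real; exact: is_derive_id.
  by rewrite mulr0 addr0 mul1r mulrA.
have cD : cCk 0 (fun l : R => w * (cexp (l%:C%C * w) * phi l) + cexp (l%:C%C * w) * cderive phi l (1 : R)).
  by apply: cCkD; [apply: cCkM; [exact: cCk_cst|exact: wave_cCk0]|exact: wave_cCk0].
apply: complex_ext => /=.
- apply: (@integral_derive_supported (fun l => Re (cexp (l%:C%C * w) * phi l))).
  + by move=> l; exact: (D l).1.
  + exact: cD.1.1.
  + by move=> l /sp ->; rewrite mulr0.
  + by move=> l lN; rewrite (sp _ lN) (sp' _ lN) !mulr0 addr0.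
- apply: (@integral_derive_supported (fun l => Im (cexp (l%:C%C * w) * phi l))).
  + by move=> l; exact: (D l).2.
  + exact: cD.2.1.
  + by move=> l /sp ->; rewrite mulr0.
  + by move=> l lN; rewrite (sp _ lN) (sp' _ lN) !mulr0 addr0.
Qed.

Lemma nderiv_cCk phi : (forall k, cCk k phi) -> forall j k, cCk k (nderiv j phi).
Proof. by move=> cp; elim => [//|j IH] k; exact: (cCk_cderive (1 : R) (IH k.+1)). Qed.

Lemma nderiv_supported phi j : supported phi -> supported (nderiv j phi).
Proof. by move=> sp; elim: j => [//|j IH]; exact: cderive_supported. Qed.

Lemma wave_by_parts_iter phi w k : (forall k, cCk k phi) -> supported phi ->
  w ^+ k * wave phi w = (-1) ^+ k * wave (nderiv k phi) w.
Proof.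
move=> cp sp; elim: k => [|k IH]; first by rewrite !expr0 !mul1r.
rewrite exprS -mulrA IH mulrCA wave_by_parts.
- by rewrite exprSr mulrN mulrN1 mulNr.
- exact: nderiv_cCk.
- exact: nderiv_supported.
Qed.

(** Stated without division, so that it also covers [w = 0]. *)
Lemma normc_wave_pow phi w k : (forall k, cCk k phi) -> supported phi -> Re w <= 0 ->
  normc w ^+ k * normc (wave phi w) <= expR (alpha * Re w) * mass (nderiv k phi).
Proof.
move=> cp sp w0; rewrite -normcX -ComplexField.Normc.normcM wave_by_parts_iter//.
rewrite ComplexField.Normc.normcM normcX normcN ComplexField.Normc.normc1 expr1n mul1r.
by apply: normc_wave => //; [exact: nderiv_cCk|exact: nderiv_supported].
Qed.

End wave.

(** * Differentiation under the integral sign *)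

Section under_integral.
Context {R : realType} d {Y : measurableType d} {mu : {measure set Y -> \bar R}}.

(** Derivability is local, so integrability and domination are asked only in a window of radius 1
    around [a]. *)
Lemma is_derive_under_integral (f f' : R -> Y -> R) (a : R) (G : Y -> R) :
  (forall h, `|h - a| < 1 -> mu.-integrable setT (EFin \o f h)) ->
  (forall h y, `|h - a| < 1 -> is_derive h (1 : R) (f^~ y) (f' h y)) ->
  mu.-integrable setT (EFin \o G) ->
  (forall h y, `|h - a| < 1 -> `|f' h y| <= G y) ->
  is_derive a (1 : R) (fun h => Rintegral mu setT (f h)) (Rintegral mu setT (f' a)).
Proof.
move=> intf df intG Gub.
have I h : `]a - 1, a + 1[%classic h -> `|h - a| < 1.
  by rewrite /= in_itv/= ltr_norml => /andP[h1 h2]; apply/andP; split; lra.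
have Ia : `]a - 1, a + 1[%classic a by rewrite /= in_itv/=; apply/andP; split; lra.
have d1E h y : `|h - a| < 1 -> partial1of2 f h y = f' h y.
  by move=> hI; rewrite partial1of2E; exact: (derive_val (is_derive := df h y hI)).
have G0 y : 0 <= G y by apply: le_trans (Gub a y _); rewrite ?subrr ?normr0.
have i1 h : `]a - 1, a + 1[%classic h -> mu.-integrable setT (EFin \o f h) by move=> /I; exact: intf.
have i2 h y : `]a - 1, a + 1[%classic h -> setT y -> derivable (f^~ y) h 1.
  by move=> /I hI _; exact: (ex_derive (is_derive := df h y hI)).
have i3 h y : `]a - 1, a + 1[%classic h -> setT y -> `|partial1of2 f h y| <= G y.
  by move=> /I hI _; rewrite d1E//; exact: Gub.
apply: DeriveDef; first exact: (@derivable_under_integral _ _ _ mu f setT measurableT a _ _ Ia i1 i2 G G0 intG i3).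
rewrite -derive1E (@differentiation_under_integral _ _ _ mu f setT measurableT a _ _ Ia i1 i2 G G0 intG i3).
by apply: eq_Rintegral => y _; rewrite d1E// subrr normr0.
Qed.

End under_integral.

Section wave_derive.
Context {R : realType}.
Local Notation leb := (@lebesgue_measure R).
Variable alpha : R.
Hypothesis alpha_gt0 : 0 < alpha.
Implicit Types (phi : R -> R[i]).

(** A window around a point of the half-plane [Re w <= 0] may leave it. A bound [M] on [Re w] still
    suffices because [l <= alpha + 1] on the support. *)
Lemma normc_wave_integrand_ub phi (w : R[i]) (M l : R) : supported alpha phi -> 0 <= M -> Re w <= M ->
  normc (cexp (l%:C%C * w) * phi l) <= expR ((alpha + 1) * M) * normc (phi l).
Proof.
move=> sp M0 wM; rewrite ComplexField.Normc.normcM normc_cexp complexReIm /= mul0r subr0.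
have [/andP[al la]|/sp ->] := boolP (alpha <= l <= alpha + 1).
  rewrite ler_wpM2r ?normc_ge0// ler_expR (le_trans (y := l * M))//.
    by rewrite ler_wpM2l// (le_trans (ltW alpha_gt0)).
  by rewrite ler_wpM2r.
by rewrite ComplexField.Normc.normc0 !mulr0.
Qed.

(** The chain rule for [wave phi] along a curve, which replaces complex differentiation in [w]. The
    bounds [M] on the real part and [K] on the speed yield the majorant for differentiating under
    the integral. *)
Lemma wave_curve phi (w w' : R -> R[i]) (a M K : R) :
  cCk 0 phi -> supported alpha phi -> 0 <= M ->
  (forall h, `|h - a| < 1 ->
    [/\ cis_derive w h (1 : R) (w' h), Re (w h) <= M & normc (w' h) <= K]) ->
  cis_derive (fun h => wave phi (w h)) a (1 : R) (w' a * wave (lmul phi) (w a)).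
Proof.
move=> cp sp M0 Hw.
have clp := lmul_cCk cp; have slp := lmul_supported sp.
have aa : `|a - a| < 1 :> R by rewrite subrr normr0.
pose F (h l : R) := cexp (l%:C%C * w h) * phi l.
pose F' (h l : R) := w' h * (cexp (l%:C%C * w h) * lmul phi l).
have dF h l : `|h - a| < 1 -> cis_derive (F^~ l) h (1 : R) (F' h l).
  move=> /Hw[dw _ _]; apply: cis_derive_eq.
    apply: (@cis_deriveM _ _ (fun h => cexp (l%:C%C * w h)) (fun=> phi l)); last exact: cis_derive_cst.
    apply: (@cis_derive_cexp _ (fun h => l%:C%C * w h)).
    by apply: (@cis_deriveM _ _ (fun=> l%:C%C) w); [exact: cis_derive_cst|exact: dw].
  by rewrite /F' /lmul; ring.
have iF h : cintegrable leb (F h) by exact: (wave_integrable _ cp sp).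
have K0 : 0 <= K by have [_ _] := Hw a aa; apply: le_trans; exact: normc_ge0.
pose G (l : R) := K * expR ((alpha + 1) * M) * normc (lmul phi l).
have iG : leb.-integrable setT (EFin \o G).
  exact: integrable_scale (cintegrable_normc (cintegrable_supported clp slp)).
have F'G h l : `|h - a| < 1 -> normc (F' h l) <= G l.
  move=> /Hw[_ wM wK]; rewrite ComplexField.Normc.normcM /G -mulrA.
  by apply: ler_pM; rewrite ?normc_ge0//; exact: normc_wave_integrand_ub.
have -> : w' a * wave (lmul phi) (w a) = cintegral leb (F' a).
  by rewrite /F' cintegralZ//; exact: (wave_integrable _ clp slp).
split.
- apply: (@is_derive_under_integral _ _ _ leb (fun h l => Re (F h l)) (fun h l => Re (F' h l)) a G) => //.
  + by move=> h _; exact: (iF h).1.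
  + by move=> h l ha; exact: (dF h l ha).1.
  + by move=> h l ha; apply: le_trans (normc_Re _) (F'G _ _ ha).
- apply: (@is_derive_under_integral _ _ _ leb (fun h l => Im (F h l)) (fun h l => Im (F' h l)) a G) => //.
  + by move=> h _; exact: (iF h).2.
  + by move=> h l ha; exact: (dF h l ha).2.
  + by move=> h l ha; apply: le_trans (normc_Im _) (F'G _ _ ha).
Qed.

(** There is no mean value equality for complex values, so the theorem is applied to each of the two
    parts, with possibly different intermediate points. *)
Lemma MVT_bound (g : R -> R[i]) (g' : R -> R[i]) (C : R) :
  (forall h : R, 0 <= h <= 1 -> cis_derive g h (1 : R) (g' h) /\ normc (g' h) <= C) ->
  `|Re (g 1) - Re (g 0)| <= C /\ `|Im (g 1) - Im (g 0)| <= C.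
Proof.
move=> Hg.
have MV (f f' : R -> R) : (forall h : R, 0 <= h <= 1 -> is_derive h (1 : R) f (f' h)) ->
    (forall h : R, 0 <= h <= 1 -> `|f' h| <= C) -> `|f 1 - f 0| <= C.
  move=> df bf.
  have cf : {within `[0, 1], continuous f}.
    apply: derivable_within_continuous => x; rewrite in_itv/= => x01.
    exact: (ex_derive (is_derive := df x x01)).
  have df' (x : R) : x \in `]0, 1[ -> is_derive x (1 : R) f (f' x).
    by rewrite in_itv/= => /andP[/ltW h1 /ltW h2]; apply: df; rewrite h1.
  have [c + ->] := MVT ltr01 df' cf; rewrite in_itv/= => /andP[/ltW h1 /ltW h2].
  by rewrite subr0 mulr1; apply: bf; rewrite h1.
split.
- apply: (MV (fun h => Re (g h)) (fun h => Re (g' h))) => h /Hg[[? ?] ?] //.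
  exact: le_trans (normc_Re _) _.
- apply: (MV (fun h => Im (g h)) (fun h => Im (g' h))) => h /Hg[[? ?] ?] //.
  exact: le_trans (normc_Im _) _.
Qed.

(** The segment from [w1] to [w2] stays in the convex set [Re w <= 0], where [wave (lmul phi)] is
    bounded by [mass (lmul phi)]. *)
Lemma wave_lipschitz phi (w1 w2 : R[i]) : cCk 0 phi -> supported alpha phi ->
  Re w1 <= 0 -> Re w2 <= 0 ->
  `|Re (wave phi w2) - Re (wave phi w1)| <= normc (w2 - w1) * mass (lmul phi) /\
  `|Im (wave phi w2) - Im (wave phi w1)| <= normc (w2 - w1) * mass (lmul phi).
Proof.
move=> cp sp w10 w20; pose d := w2 - w1.
pose w (h : R) := w1 + h%:C%C * d.
have w_1 : w 1 = w2 by rewrite /w mul1r addrC subrK.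
have w_0 : w 0 = w1 by rewrite /w mul0r addr0.
have dw (h : R) : cis_derive w h (1 : R) d.
  apply: cis_derive_eq.
    apply: (@cis_deriveD _ _ (fun=> w1) (fun h : R => h%:C%C * d)); first exact: cis_derive_cst.
    apply: (@cis_deriveM _ _ (fun h : R => h%:C%C) (fun=> d)); last exact: cis_derive_cst.
    by apply: cis_derive_real; exact: is_derive_id.
  by rewrite mulr0 addr0 add0r mul1r.
rewrite -w_1 -w_0; apply: (@MVT_bound (fun h => wave phi (w h))
  (fun h => d * wave (lmul phi) (w h))) => h /andP[h0 h1]; split.
  (* The window of radius 1 around [h] in [0, 1] contains only [k] with |k| < 2, and [Re w1 <= 0];
     hence the bound [2 |Re d|] on the real part. *)
  apply: (@wave_curve phi w (fun=> d) h (2 * `|Re d|) (normc d)) => //.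
  move=> k kh; split => //; rewrite /w !complexReIm /= mul0r subr0.
  rewrite -[leRHS]add0r lerD//; apply: le_trans (ler_norm _) _; rewrite normrM ler_wpM2r//.
  have -> : k = (k - h) + h by ring.
  apply: le_trans (ler_normD _ _) _; rewrite (ger0_norm h0).
  by have := ltW kh; lra.
rewrite w_1 w_0 ComplexField.Normc.normcM ler_wpM2l ?normc_ge0//.
have wh : Re (w h) <= 0.
  rewrite /w /d !complexReIm /= mul0r subr0 -/(GRing.opp _).
  have -> : Re w1 + h * (Re w2 - Re w1) = (1 - h) * Re w1 + h * Re w2 by ring.
  by rewrite -[leRHS]addr0 lerD// mulr_ge0_le0// subr_ge0.
have := normc_wave (lmul_cCk cp) (lmul_supported sp) wh.
move/le_trans; apply; rewrite ler_piMl ?mass_ge0//.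
by rewrite -[leRHS]expR0 ler_expR mulr_ge0_le0// ltW.
Qed.

End wave_derive.

(** * Packets as functions on the Heisenberg group *)

Section packet.
Context {R : realType} {n : nat}.
Local Notation leb := (@lebesgue_measure R).
Local Notation heis := (heis R n).
Variable alpha : R.
Hypothesis alpha_gt0 : 0 < alpha.
Implicit Types (phi : R -> R[i]) (p v : heis).

(* The exponent [i t - |z|^2 / 4], so that [packet_init phi p] is [wave phi (wt p)]. *)
Definition wt p : R[i] := (- (znorm2 p / 4) +i* p.2)%C.

Lemma znorm2_ge0 p : 0 <= znorm2 p.
Proof. by apply: sumr_ge0 => j _; rewrite addr_ge0// sqr_ge0. Qed.

Lemma Re_wt p : Re (wt p) <= 0.
Proof. by rewrite /= oppr_le0 divr_ge0// znorm2_ge0. Qed.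

Lemma packet_initE phi p : supported alpha phi ->
  packet_init phi p = wave phi (wt p).
Proof.
move=> sp; congr (cintegral _ _); apply/funext => l.
have [/andP[al _]|/sp ->] := boolP (alpha <= l <= alpha + 1); last by rewrite !mulr0.
rewrite ger0_norm ?(le_trans (ltW alpha_gt0))//; congr (cexp (_ * _) * _).
by apply: complex_ext; rewrite !complexReIm /=; ring.
Qed.

(** The Euclidean inner product of the z-components, that is, the polarization of [znorm2]. *)
Definition bil v p : R := \sum_(j < n) (v.1.1 ord0 j * p.1.1 ord0 j + v.1.2 ord0 j * p.1.2 ord0 j).

Lemma bil_ge0 v : 0 <= bil v v.
Proof. by apply: sumr_ge0 => j _; rewrite addr_ge0// -expr2 sqr_ge0. Qed.

Lemma znorm2_line v p (h : R) :
  znorm2 (h *: v + p) = h ^+ 2 * bil v v + 2 * h * bil v p + znorm2 p.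
Proof.
rewrite /znorm2 /bil !mulr_sumr -!big_split/=; apply: eq_bigr => j _.
by rewrite !mxE; ring.
Qed.

Lemma cis_derive_wt_line v p (h : R) :
  cis_derive (fun h : R => wt (h *: v + p)) h (1 : R) (- ((h * bil v v + bil v p) / 2) +i* v.2)%C.
Proof.
split => /=.
  under eq_fun do rewrite znorm2_line.
  pose a2 := - bil v v / 4; pose a1 := - bil v p / 2; pose a0 := - (znorm2 p / 4).
  rewrite (_ : (fun q : R => _) = (fun q => a2 * (q * q) + (a1 * q + a0))); last first.
    by apply/funext => q; rewrite /a2 /a1 /a0; field.
  have di := is_derive_id h (1 : R).
  have dc (c : R) := is_derive_funC c h (1 : R).
  apply: (is_derive_eq (is_derive_funD (is_derive_funM (dc a2) (is_derive_funM di di))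
    (is_derive_funD (is_derive_funM (dc a1) di) (dc a0)))).
  by rewrite /a2 /a1; field.
have di := is_derive_id h (1 : R).
have dc (c : R) := is_derive_funC c h (1 : R).
apply: (is_derive_eq (is_derive_funD (is_derive_funM di (dc v.2)) (dc p.2))).
by rewrite mul1r mulr0 !addr0.
Qed.

(** The factor is the derivative of [wt] along [v], affine in [p], and the new profile [lmul phi]
    has the same support properties; the statement can therefore be iterated. *)
Lemma cis_derive_packet_init phi p v : cCk 0 phi -> supported alpha phi ->
  cis_derive (packet_init phi) p v
    ((- (bil v p / 2) +i* v.2)%C * packet_init (lmul phi) p).
Proof.
move=> cp sp; apply: cis_derive_of_line.
under [X in cis_derive X]eq_fun do rewrite packet_initE//.
rewrite packet_initE; last exact: lmul_supported.
(* [wt] never leaves the half-plane, so the bound on the real part is 0; the last constant bounds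
   the speed of the line for [|h| < 1]. *)
have := @wave_curve _ alpha alpha_gt0 phi (fun h : R => wt (h *: v + p))
  (fun h : R => (- ((h * bil v v + bil v p) / 2) +i* v.2)%C) 0 0
  ((bil v v + `|bil v p|) / 2 + `|v.2|) cp sp (lexx 0).
rewrite scale0r add0r mul0r add0r; apply => h; rewrite subr0 => h1; split.
- exact: cis_derive_wt_line.
- exact: Re_wt.
- apply: le_trans (normc_le _) _; rewrite /= lerD2r normrN normrM [`|2^-1|]ger0_norm//.
  rewrite ler_pM2r ?invr_gt0//; apply: le_trans (ler_normD _ _) _.
  by rewrite lerD2r normrM (ger0_norm (bil_ge0 _)) ler_piMl ?bil_ge0 ?ltW.
Qed.

Lemma linear_heis_x (j : 'I_n) : linear (fun p : heis => p.1.1 ord0 j).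
Proof. by move=> a p q /=; rewrite !mxE. Qed.

Lemma linear_heis_y (j : 'I_n) : linear (fun p : heis => p.1.2 ord0 j).
Proof. by move=> a p q /=; rewrite !mxE. Qed.

Lemma Ck_heis_x k j : Ck k (fun p : heis => p.1.1 ord0 j).
Proof. apply: Ck_linear; [exact: linear_heis_x|exact: continuous_heis_x]. Qed.

Lemma Ck_heis_y k j : Ck k (fun p : heis => p.1.2 ord0 j).
Proof. apply: Ck_linear; [exact: linear_heis_y|exact: continuous_heis_y]. Qed.

Lemma Ck_sum (V : normedModType R) k (I : Type) (r : seq I) (F : I -> V -> R) :
  (forall i, Ck k (F i)) -> Ck k (fun x => \sum_(i <- r) F i x).
Proof.
move=> HF; elim: r => [|i r IH].
  by under eq_fun do rewrite big_nil; exact: Ck_cst.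
by under eq_fun do rewrite big_cons; exact: CkD.
Qed.

Lemma Ck_znorm2 k : Ck k (fun p : heis => znorm2 p).
Proof.
apply: (@Ck_sum _ _ _ _ (fun j (p : heis) => p.1.1 ord0 j ^+ 2 + p.1.2 ord0 j ^+ 2)) => j.
by apply: CkD; apply: CkM; rewrite ?expr1; [exact: Ck_heis_x|exact: Ck_heis_x|exact: Ck_heis_y|exact: Ck_heis_y].
Qed.

Lemma Ck_bil k v : Ck k (fun p : heis => bil v p).
Proof.
apply: (@Ck_sum _ _ _ _ (fun j (p : heis) => v.1.1 ord0 j * p.1.1 ord0 j + v.1.2 ord0 j * p.1.2 ord0 j)) => j.
by apply: CkD; apply: CkM; [exact: Ck_cst|exact: Ck_heis_x|exact: Ck_cst|exact: Ck_heis_y].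
Qed.

Lemma continuous_packet_init phi : cCk 0 phi -> supported alpha phi -> cCk 0 (packet_init phi : heis -> R[i]).
Proof.
move=> cp sp.
have cwt p : (fun q => `|znorm2 q - znorm2 p| / 4 + `|q.2 - p.2|) q @[q --> p] --> (0 : R).
  rewrite -[X in _ --> X]addr0; apply: cvgD.
    rewrite -[X in _ --> X](mul0r (4^-1)); apply: cvgM; last exact: cvg_cst.
    apply/norm_cvg0P/subr_cvg0; exact: (Ck_continuous (Ck_znorm2 0)).
  by apply/norm_cvg0P/subr_cvg0; exact: continuous_heis_t.
have wtd p q : normc (wt q - wt p) <= `|znorm2 q - znorm2 p| / 4 + `|q.2 - p.2|.
  apply: le_trans (normc_le _) _; rewrite !complexReIm /= lerD2r.
  have -> : - (znorm2 q / 4) - - (znorm2 p / 4) = - (znorm2 q - znorm2 p) / 4 by field.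
  by rewrite normrM normrN [`|4^-1|]ger0_norm.
have cm p : (fun q => (`|znorm2 q - znorm2 p| / 4 + `|q.2 - p.2|) * mass (lmul phi)) q @[q --> p] --> (0 : R).
  by rewrite -[X in _ --> X](mul0r (mass (lmul phi))); apply: cvgM => //; exact: cvg_cst.
have L p q := wave_lipschitz alpha_gt0 cp sp (Re_wt p) (Re_wt q).
split; split => // p; apply/subr_cvg0; apply/norm_cvg0P;
  apply: (@squeeze_cvgr _ _ _ _ (cst 0) _ _ _ _ _ (cm p)); [|exact: cvg_cst| |exact: cvg_cst];
  apply: nearW => q; rewrite [cst 0 q]/(0 : R) normr_ge0 andTb !packet_initE//.
- apply: le_trans (L p q).1 _; rewrite ler_wpM2r ?mass_ge0//; exact: wtd.
- apply: le_trans (L p q).2 _; rewrite ler_wpM2r ?mass_ge0//; exact: wtd.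
Qed.

(** Smoothness in [p] comes from the compact frequency support: each derivative costs a factor [l],
    not a derivative of [phi]. The induction must range over all profiles, since a derivative of the
    packet involves [lmul phi]. *)
Lemma cCk_packet_init k phi : cCk 0 phi -> supported alpha phi -> cCk k (packet_init phi : heis -> R[i]).
Proof.
elim: k phi => [|k IH] phi cp sp; first exact: continuous_packet_init.
have [c1 c2] := continuous_packet_init cp sp.
have D p v := cis_derive_packet_init p v cp sp.
have clp := lmul_cCk cp; have slp := lmul_supported sp.
have H v : cCk k (fun p => (- (bil v p / 2) +i* v.2)%C * packet_init (lmul phi) p).
  apply: cCkM; last exact: IH.
  split => /=; last exact: Ck_cst.
  by apply: CkN; apply: CkM; [exact: Ck_bil|exact: Ck_cst].
split; split.
- exact: c1.1.
- move=> v; split; first by move=> p; exact: (ex_derive (is_derive := (D p v).1)).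
  rewrite (_ : (fun p => _) = (fun p => Re ((- (bil v p / 2) +i* v.2)%C * packet_init (lmul phi) p))); first exact: (H v).1.
  by apply/funext => p; exact: (derive_val (is_derive := (D p v).1)).
- exact: c2.1.
- move=> v; split; first by move=> p; exact: (ex_derive (is_derive := (D p v).2)).
  rewrite (_ : (fun p => _) = (fun p => Im ((- (bil v p / 2) +i* v.2)%C * packet_init (lmul phi) p))); first exact: (H v).2.
  by apply/funext => p; exact: (derive_val (is_derive := (D p v).2)).
Qed.

End packet.

(** * The Schroedinger equation *)

Section vector_fields.
Context {R : realType} {n : nat}.
Local Notation heis := (heis R n).
Implicit Types (f g : heis -> R[i]) (p v : heis).

Lemma cis_derive_vecX j f p dx dt :
  cis_derive f p (dir_x j) dx -> cis_derive f p dir_t dt ->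
  vecX j f p = dx + (p.1.2 ord0 j / 2)%:C%C * dt.
Proof. by move=> h1 h2; rewrite /vecX (cis_derive_val h1) (cis_derive_val h2). Qed.

Lemma cis_derive_vecY j f p dy dt :
  cis_derive f p (dir_y j) dy -> cis_derive f p dir_t dt ->
  vecY j f p = dy - (p.1.1 ord0 j / 2)%:C%C * dt.
Proof. by move=> h1 h2; rewrite /vecY (cis_derive_val h1) (cis_derive_val h2). Qed.

Lemma vecXM j f g p : (forall v, cderivable f p v) -> (forall v, cderivable g p v) ->
  vecX j (fun q => f q * g q) p = vecX j f p * g p + f p * vecX j g p.
Proof.
move=> df dg.
rewrite (cis_derive_vecX (cis_deriveM (cderivableP (df _)) (cderivableP (dg _)))
  (cis_deriveM (cderivableP (df _)) (cderivableP (dg _)))) /vecX.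
move: (cderive f p (dir_x j)) (cderive f p dir_t) (cderive g p (dir_x j)) (cderive g p dir_t).
by move: (f p) (g p) (_%:C)%C => a b c d e h k; ring.
Qed.

Lemma vecYM j f g p : (forall v, cderivable f p v) -> (forall v, cderivable g p v) ->
  vecY j (fun q => f q * g q) p = vecY j f p * g p + f p * vecY j g p.
Proof.
move=> df dg.
rewrite (cis_derive_vecY (cis_deriveM (cderivableP (df _)) (cderivableP (dg _)))
  (cis_deriveM (cderivableP (df _)) (cderivableP (dg _)))) /vecY.
move: (cderive f p (dir_y j)) (cderive f p dir_t) (cderive g p (dir_y j)) (cderive g p dir_t).
by move: (f p) (g p) (_%:C)%C => a b c d e h k; ring.
Qed.

Lemma vecXB j f g p : (forall v, cderivable f p v) -> (forall v, cderivable g p v) ->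
  vecX j (fun q => f q - g q) p = vecX j f p - vecX j g p.
Proof.
move=> df dg.
rewrite (cis_derive_vecX (cis_deriveD (cderivableP (df _)) (cis_deriveN (cderivableP (dg _))))
  (cis_deriveD (cderivableP (df _)) (cis_deriveN (cderivableP (dg _))))) /vecX.
move: (cderive f p (dir_x j)) (cderive f p dir_t) (cderive g p (dir_x j)) (cderive g p dir_t).
by move: (f p) (g p) (_%:C)%C => a b c d e h k; ring.
Qed.

Lemma vecYB j f g p : (forall v, cderivable f p v) -> (forall v, cderivable g p v) ->
  vecY j (fun q => f q - g q) p = vecY j f p - vecY j g p.
Proof.
move=> df dg.
rewrite (cis_derive_vecY (cis_deriveD (cderivableP (df _)) (cis_deriveN (cderivableP (dg _))))
  (cis_deriveD (cderivableP (df _)) (cis_deriveN (cderivableP (dg _))))) /vecY.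
move: (cderive f p (dir_y j)) (cderive f p dir_t) (cderive g p (dir_y j)) (cderive g p dir_t).
by move: (f p) (g p) (_%:C)%C => a b c d e h k; ring.
Qed.

End vector_fields.

(** * The packet as a classical solution *)

Section classical.
Context {R : realType} {n : nat}.
Local Notation heis := (heis R n).
Variable alpha : R.
Hypothesis alpha_gt0 : 0 < alpha.
Implicit Types (phi : R -> R[i]) (p v : heis).

Lemma bil_dir_x j p : bil (dir_x j) p = p.1.1 ord0 j.
Proof.
rewrite /bil (bigD1 j)//= big1 ?addr0; last first.
  by move=> i ij; rewrite !mxE eqxx (negbTE ij) !mul0r addr0.
by rewrite !mxE !eqxx mul1r mul0r addr0.
Qed.

Lemma bil_dir_y j p : bil (dir_y j) p = p.1.2 ord0 j.
Proof.
rewrite /bil (bigD1 j)//= big1 ?addr0; last first.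
  by move=> i ij; rewrite !mxE eqxx (negbTE ij) !mul0r addr0.
by rewrite !mxE !eqxx mul1r mul0r add0r.
Qed.

Lemma bil_dir_t p : bil dir_t p = 0.
Proof. by rewrite /bil big1// => j _; rewrite !mxE !mul0r addr0. Qed.

(* [X_j] and [Y_j] act on [exp (l * wt p)] as multiplication by [l * symX j p] and
   [l * symY j p]. *)
Definition symX (j : 'I_n) p : R[i] := (- (p.1.1 ord0 j / 2) +i* (p.1.2 ord0 j / 2))%C.
Definition symY (j : 'I_n) p : R[i] := (- (p.1.2 ord0 j / 2) +i* (- (p.1.1 ord0 j / 2)))%C.

Lemma vecX_packet_init j phi p : cCk 0 phi -> supported alpha phi ->
  vecX j (packet_init phi) p = symX j p * packet_init (lmul phi) p.
Proof.
move=> cp sp; rewrite (cis_derive_vecX (cis_derive_packet_init alpha_gt0 _ _ cp sp)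
  (cis_derive_packet_init alpha_gt0 _ _ cp sp)).
rewrite bil_dir_x bil_dir_t mulrA -mulrDl; congr (_ * _).
by apply: complex_ext; rewrite !complexReIm /=; ring.
Qed.

Lemma vecY_packet_init j phi p : cCk 0 phi -> supported alpha phi ->
  vecY j (packet_init phi) p = symY j p * packet_init (lmul phi) p.
Proof.
move=> cp sp; rewrite (cis_derive_vecY (cis_derive_packet_init alpha_gt0 _ _ cp sp)
  (cis_derive_packet_init alpha_gt0 _ _ cp sp)).
rewrite bil_dir_y bil_dir_t mulrA -mulrBl; congr (_ * _).
by apply: complex_ext; rewrite !complexReIm /=; ring.
Qed.

Lemma is_derive_heis_x j p v : is_derive p v (fun q : heis => q.1.1 ord0 j) (v.1.1 ord0 j).
Proof. exact: (@is_derive_linear _ _ (fun q : heis => q.1.1 ord0 j) p v (linear_heis_x j)). Qed.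

Lemma is_derive_heis_y j p v : is_derive p v (fun q : heis => q.1.2 ord0 j) (v.1.2 ord0 j).
Proof. exact: (@is_derive_linear _ _ (fun q : heis => q.1.2 ord0 j) p v (linear_heis_y j)). Qed.

Lemma is_derive_half (f : heis -> R) p v (d : R) : is_derive p v f d ->
  is_derive p v (fun q => f q / 2) (d / 2).
Proof.
move=> df; apply: (is_derive_eq (is_derive_funM df (is_derive_funC 2^-1 p v))).
by rewrite mulr0 addr0.
Qed.

Lemma is_derive_funN (f : heis -> R) p v (d : R) : is_derive p v f d ->
  is_derive p v (fun q => - f q) (- d).
Proof. exact: is_deriveN. Qed.

Lemma cis_derive_symX j p v :
  cis_derive (symX j) p v (- (v.1.1 ord0 j / 2) +i* (v.1.2 ord0 j / 2))%C.
Proof.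
split => /=.
  by apply: is_derive_funN; apply: is_derive_half; exact: is_derive_heis_x.
by apply: is_derive_half; exact: is_derive_heis_y.
Qed.

Lemma cis_derive_symY j p v :
  cis_derive (symY j) p v (- (v.1.2 ord0 j / 2) +i* (- (v.1.1 ord0 j / 2)))%C.
Proof.
split => /=; apply: is_derive_funN; apply: is_derive_half.
  exact: is_derive_heis_y.
exact: is_derive_heis_x.
Qed.

Lemma sublaplacian_packet_init phi p : cCk 0 phi -> supported alpha phi ->
  sublaplacian (packet_init phi) p = - (n%:R%:C%C * packet_init (lmul phi) p).
Proof.
move=> cp sp; have clp := lmul_cCk cp; have slp := lmul_supported sp.
have dU q v : cderivable (packet_init (lmul phi) : heis -> R[i]) q v.
  exact: cis_derivable (cis_derive_packet_init alpha_gt0 _ _ clp slp).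
have dX j q v : cderivable (symX j) q v by exact: cis_derivable (cis_derive_symX _ _ _).
have dY j q v : cderivable (symY j) q v by exact: cis_derivable (cis_derive_symY _ _ _).
rewrite /sublaplacian.
have X j : vecX j (packet_init phi) = fun q => symX j q * packet_init (lmul phi) q.
  by apply/funext => q; exact: vecX_packet_init.
have Y j : vecY j (packet_init phi) = fun q => symY j q * packet_init (lmul phi) q.
  by apply/funext => q; exact: vecY_packet_init.
transitivity (\sum_(j < n) - packet_init (lmul phi) p); last first.
  rewrite sumr_const card_ord mulNrn; congr (- _).
  rewrite -[LHS]mulr_natl; congr (_ * _).
  by rewrite (rmorph_nat (real_complex R)).
apply: eq_bigr => j _; rewrite X Y vecXM// vecYM// vecX_packet_init// vecY_packet_init//.
rewrite (cis_derive_vecX (cis_derive_symX j p _) (cis_derive_symX j p _)).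
rewrite (cis_derive_vecY (cis_derive_symY j p _) (cis_derive_symY j p _)).
rewrite !mxE !eqxx /=.
set U := packet_init (lmul phi) p; set U2 := packet_init (lmul (lmul phi)) p.
rewrite !mulrA addrACA -!mulrDl.
have c2 : symX j p * symX j p + symY j p * symY j p = 0.
  by apply: complex_ext; rewrite !complexReIm /symX /symY /=; ring.
(* Only the derivatives of the symbols survive: [X_j (symX j) + Y_j (symY j)] is -1/2 - 1/2 = -1 for
   each of the [n] indices. *)
rewrite c2 [0 * U2]mul0r [LHS]addr0 -[RHS]mulN1r; congr (_ * _).
by apply: complex_ext; rewrite !complexReIm /=; field.
Qed.

(* Evolving for time [s] multiplies the frequency [l] by [exp (- i n l s)]. *)
Definition rot (c : R) phi : R -> R[i] := fun l => cexp (l%:C%C * (0 +i* c)%C) * phi l.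

Lemma rot_cCk0 c phi : cCk 0 phi -> cCk 0 (rot c phi).
Proof. exact: wave_cCk0. Qed.

Lemma rot_supported c phi : supported alpha phi -> supported alpha (rot c phi).
Proof. exact: supportedMl. Qed.

Lemma wave_rot c phi w : wave (rot c phi) w = wave phi (w + (0 +i* c)%C).
Proof. by congr (cintegral _ _); apply/funext => l; rewrite /rot mulrA -cexpD -mulrDr. Qed.

Lemma wt_central p (c : R) : wt (p.1, p.2 + c) = wt p + (0 +i* c)%C.
Proof. by apply: complex_ext; rewrite !complexReIm /= ?addr0. Qed.

(** A packet at time [s] is an initial packet whose profile carries a unimodular factor, so spatial
    facts proved for initial data hold at all times. *)
Lemma packet_rot phi s p : supported alpha phi ->
  packet phi s p = packet_init (rot (- (n%:R * s)) phi) p.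
Proof.
move=> sp; rewrite /packet (packet_initE alpha_gt0)// (packet_initE alpha_gt0); last exact: rot_supported.
by rewrite wave_rot wt_central.
Qed.

Lemma lmul_rot c phi : lmul (rot c phi) = rot c (lmul phi).
Proof. by apply/funext => l; rewrite /lmul /rot mulrCA. Qed.

Lemma cis_derive_packet_time phi (s : R) p : cCk 0 phi -> supported alpha phi ->
  cis_derive (fun r : R => packet phi r p) s (1 : R) ((0 +i* (- n%:R))%C * packet (lmul phi) s p).
Proof.
move=> cp sp.
rewrite /packet (packet_initE alpha_gt0); last exact: lmul_supported.
under [X in cis_derive X]eq_fun do rewrite (packet_initE alpha_gt0)//.
apply: (@wave_curve _ alpha alpha_gt0 phi (fun r : R => wt (p.1, p.2 - n%:R * r))
  (fun=> (0 +i* (- n%:R))%C) s 0 (n%:R) cp sp (lexx 0)) => h _; split.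
- split.
    rewrite (_ : (fun q : R => _) = (fun=> Re (wt p)))//; exact: is_derive_funC.
  rewrite /=.
  apply: (is_derive_eq (is_derive_funB (is_derive_funC p.2 h 1) (is_derive_funM (is_derive_funC n%:R h 1) (is_derive_id h (1 : R))))).
  by rewrite mul0r mulr1 sub0r add0r.
- exact: Re_wt.
- by rewrite /= expr0n/= add0r sqrrN sqrtr_sqr ger0_norm.
Qed.

Lemma packet_classical phi : cCk 0 phi -> supported alpha phi ->
  classical_solution (packet phi : R -> heis -> R[i]).
Proof.
move=> cp sp; have clp := lmul_cCk cp; have slp := lmul_supported sp.
have E s : packet phi s = packet_init (rot (- (n%:R * s)) phi) :> (heis -> R[i]).
  by apply/funext => p; exact: packet_rot.
split=> [s|s p].
  by rewrite E; apply: (cCk_packet_init alpha_gt0); [exact: rot_cCk0|exact: rot_supported].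
have D := cis_derive_packet_time s p cp sp.
split; first exact: cis_derivable D.
rewrite (cis_derive_val D) E sublaplacian_packet_init; [|exact: rot_cCk0|exact: rot_supported].
rewrite lmul_rot -packet_rot// mulrA -mulrBl [X in X * _](_ : _ = 0) ?mul0r//.
by apply: complex_ext; rewrite !complexReIm /=; ring.
Qed.

End classical.

(** * Decay, domination and continuity in L^2 *)

Section bounds.
Context {R : realType} {n : nat}.
Local Notation heis := (heis R n).
Local Notation W := (@heis_prod R n cauchy_fun).
Variable alpha : R.
Hypothesis alpha_gt0 : 0 < alpha.
Implicit Types (phi : R -> R[i]) (p v : heis).

Lemma normc_wt p : normc (wt p) = Num.sqrt (p.2 ^+ 2 + znorm2 p ^+ 2 / 16).
Proof. by rewrite /= addrC; congr (Num.sqrt (_ + _)); field. Qed.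

Lemma packet_wave phi s p : supported alpha phi ->
  packet phi s p = wave phi (wt (p.1, p.2 - n%:R * s)).
Proof. by move=> sp; rewrite /packet (packet_initE alpha_gt0). Qed.

Lemma expR_wt (p : heis) c : expR (alpha * Re (wt (p.1, c))) = expR (- alpha * znorm2 p / 4).
Proof. by congr expR; rewrite /= -/(znorm2 p); field. Qed.

Lemma normc_packet phi s p : cCk 0 phi -> supported alpha phi ->
  normc (packet phi s p) <= expR (- alpha * znorm2 p / 4) * mass phi.
Proof.
move=> cp sp; rewrite packet_wave// -(expR_wt p (p.2 - n%:R * s)).
by apply: normc_wave => //; exact: Re_wt.
Qed.

Lemma normc_packet_pow phi s p k : (forall k, cCk k phi) -> supported alpha phi ->
  Num.sqrt ((p.2 - n%:R * s) ^+ 2 + znorm2 p ^+ 2 / 16) ^+ k * normc (packet phi s p) <=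
  expR (- alpha * znorm2 p / 4) * mass (nderiv k phi).
Proof.
move=> cp sp; rewrite packet_wave// -(expR_wt p (p.2 - n%:R * s)).
rewrite -(_ : normc (wt (p.1, p.2 - n%:R * s)) = Num.sqrt _); last exact: normc_wt.
by apply: normc_wave_pow => //; exact: Re_wt.
Qed.

Lemma L1norm_packet_bound phi s p : cCk 0 phi -> supported alpha phi ->
  ((normc (packet phi s p))%:E <= L1norm phi * (expR (- alpha * znorm2 p / 4))%:E)%E.
Proof.
by move=> cp sp; rewrite (L1normE cp sp) -EFinM lee_fin mulrC; exact: normc_packet.
Qed.

Lemma L1norm_packet_decay phi k s p : (forall k, cCk k phi) -> supported alpha phi ->
  let D := (p.2 - n%:R * s) ^+ 2 + znorm2 p ^+ 2 / 16 in
  0 < D ->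
  ((normc (packet phi s p))%:E
     <= L1norm (nderiv k phi) * (expR (- alpha * znorm2 p / 4) / D `^ (k%:R / 2))%:E)%E.
Proof.
move=> cp sp D D0.
rewrite (L1normE (nderiv_cCk cp k 0) (nderiv_supported k sp)) -EFinM lee_fin.
have -> : D `^ (k%:R / 2) = Num.sqrt D ^+ k.
  by rewrite mulrC powRrM (powR12_sqrt (ltW D0)) powR_mulrn ?sqrtr_ge0.
rewrite mulrA ler_pdivlMr ?exprn_gt0 ?sqrtr_gt0// mulrC [leRHS]mulrC.
exact: normc_packet_pow.
Qed.

(** From [1 + y <= expR y] at y = c x^2, since (1 + 1/c) (1 + c x^2) exceeds 1 + x^2 by 1/c + c
    x^2. *)
Lemma expR_cauchy (c x : R) : 0 < c -> expR (- (c * x ^+ 2)) <= (1 + c^-1) * cauchy_fun x.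
Proof.
move=> c0; rewrite expRN /cauchy_fun -[leLHS]mul1r ler_pdivrMr ?expR_gt0//.
have x0 : 0 < 1 + x ^+ 2 by rewrite ltr_wpDr ?sqr_ge0.
rewrite mulrAC ler_pdivlMr// mul1r.
apply: le_trans (_ : (1 + c^-1) * (1 + c * x ^+ 2) <= _).
  have -> : (1 + c^-1) * (1 + c * x ^+ 2) = 1 + x ^+ 2 + (c^-1 + c * x ^+ 2).
    by field; rewrite gt_eqF.
  by rewrite lerDl; apply: addr_ge0; [rewrite invr_ge0 ltW|rewrite mulr_ge0 ?sqr_ge0 ?ltW].
by rewrite ler_pM2l ?expR_ge1Dx// addr_gt0// invr_gt0.
Qed.

Lemma expR_sum (m : nat) (F : 'I_m -> R) : expR (\sum_(j < m) F j) = \prod_(j < m) expR (F j).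
Proof.
elim: m F => [|m IH] F; first by rewrite !big_ord0 expR0.
by rewrite !big_ord_recl expRD IH.
Qed.

(** Each of the [n + n] horizontal coordinates costs one factor [1 + c^-1]; the central factor is
    present on both sides. *)
Lemma gauss_cauchy (c : R) p : 0 < c ->
  expR (- (c * znorm2 p)) * cauchy_fun p.2 <= (1 + c^-1) ^+ (n + n) * W p.
Proof.
move=> c0; rewrite /heis_prod mulrA ler_wpM2r ?(ltW (cauchy_fun_gt0 _))//.
rewrite /znorm2 big_split /= mulrDr opprD expRD !mulr_sumr -!sumrN !expR_sum exprD mulrACA.
have H (F : 'I_n -> R) : \prod_(j < n) expR (- (c * F j ^+ 2)) <=
    (1 + c^-1) ^+ n * \prod_(j < n) cauchy_fun (F j).
  rewrite -[X in _ ^+ X]card_ord -prodr_const -big_split/=; apply: ler_prod => j _.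
  by rewrite expR_ge0/=; exact: expR_cauchy.
have P (F : 'I_n -> R) : 0 <= \prod_(j < n) expR (F j) by apply: prodr_ge0 => j _; exact: expR_ge0.
by apply: ler_pM; [exact: P|exact: P|exact: H|exact: H].
Qed.

Lemma W_central p (c : R) : W (p.1, p.2 + c) <= 2 * (1 + c ^+ 2) * W p.
Proof.
rewrite /heis_prod /= mulrCA ler_wpM2l ?cauchy_fun_shift//.
by apply: mulr_ge0; apply: prodr_ge0 => j _; exact: ltW (cauchy_fun_gt0 _).
Qed.

(** The decay estimates for k = 0 and k = 2 add up to a bound on (1 + t^2) |u_0|, because |w|^2 >=
    t^2. This gives the central factor of [W]; the Gaussian gives the others. *)
Lemma packet_init_dominated phi : (forall k, cCk k phi) -> supported alpha phi ->
  exists C, 0 <= C /\ forall p, normc (packet_init phi p) <= C * W p.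
Proof.
move=> cp sp.
exists ((mass phi + mass (nderiv 2 phi)) * (1 + (alpha / 4)^-1) ^+ (n + n)).
have a4 : 0 < alpha / 4 by rewrite divr_gt0.
split.
  by rewrite mulr_ge0 ?addr_ge0 ?mass_ge0// exprn_ge0// addr_ge0// invr_ge0 ltW.
move=> p; rewrite -mulrA.
apply: le_trans (_ : (mass phi + mass (nderiv 2 phi)) * (expR (- (alpha / 4 * znorm2 p)) * cauchy_fun p.2) <= _); last first.
  by rewrite ler_wpM2l ?addr_ge0 ?mass_ge0//; exact: gauss_cauchy.
have p0 : packet_init phi p = packet phi 0 p.
  by rewrite /packet mulr0 subr0; case: p.
rewrite p0 mulrA /cauchy_fun ler_pdivlMr ?ltr_wpDr ?sqr_ge0// mulrDr mulr1 mulrDl.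
have eE : expR (- (alpha / 4 * znorm2 p)) = expR (- alpha * znorm2 p / 4).
  by congr expR; field.
apply: lerD; first by rewrite mulrC eE; exact: normc_packet.
have := @normc_packet_pow phi 0 p 2 cp sp; rewrite -eE [leRHS]mulrC; apply: le_trans.
move: (normc _) (normc_ge0 (packet phi 0 p)) => N N0.
rewrite mulrC ler_wpM2r// mulr0 subr0 sqr_sqrtr ?lerDl ?addr_ge0 ?sqr_ge0//;
  by rewrite divr_ge0// sqr_ge0.
Qed.

(** Up to time [T] the packet is shifted by at most [n T] in t, so one comparison constant for
    translates of [W] serves the whole time interval. *)
Lemma packet_dominated phi (T : R) : (forall k, cCk k phi) -> supported alpha phi ->
  exists C, 0 <= C /\ forall s p, `|s| <= T -> normc (packet phi s p) <= C * W p.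
Proof.
move=> cp sp; have [C [C0 HC]] := packet_init_dominated cp sp.
exists (C * (2 * (1 + (n%:R * T) ^+ 2))); split.
  by rewrite mulr_ge0// mulr_ge0// addr_ge0// sqr_ge0.
move=> s p sT; rewrite /packet -mulrA; apply: le_trans (HC _) _; rewrite ler_wpM2l//.
apply: le_trans (W_central _ _) _; rewrite ler_wpM2r ?(ltW (heis_cauchy_gt0 _))//.
rewrite ler_pM2l// lerD2l sqrrN !exprMn ler_wpM2l ?sqr_ge0//.
by rewrite -[s ^+ 2]real_normK ?num_real// ler_pXn2r ?nnegrE// (le_trans (normr_ge0 _) sT).
Qed.

(** The time derivative is -i n times the packet of [lmul phi], which is dominated uniformly for
    times up to [|s| + 1]. *)
Lemma packet_lipschitz phi (s : R) : (forall k, cCk k phi) -> supported alpha phi ->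
  exists C, 0 <= C /\ forall r p, `|r - s| <= 1 ->
    normc (packet phi r p - packet phi s p) <= `|r - s| * C * W p.
Proof.
move=> cp sp.
have clp k := lmul_cCk (cp k); have slp := lmul_supported sp.
have [C [C0 HC]] := packet_dominated (`|s| + 1) clp slp.
(* The factor 2 adds the bounds on the real and imaginary parts. *)
exists (2 * (n%:R * C)); split; first by rewrite !mulr_ge0.
move=> r p rs1.
pose g (h : R) := packet phi (s + h * (r - s)) p.
pose g' (h : R) := (0 +i* (- n%:R))%C * (r - s)%:C%C * packet (lmul phi) (s + h * (r - s)) p.
have g1 : g 1 = packet phi r p by rewrite /g mul1r addrC subrK.
have g0 : g 0 = packet phi s p by rewrite /g mul0r addr0.
have [] := @MVT_bound R g g' (n%:R * `|r - s| * (C * W p)).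
  move=> h /andP[h0 h1]; split.
    have [D1 D2] := cis_derive_packet_time alpha_gt0 (s + h * (r - s)) p (cp 0%N) sp.
    have dl : is_derive h (1 : R) (fun h : R => s + h * (r - s)) (r - s).
      apply: (is_derive_eq (is_derive_funD (is_derive_funC s h 1)
        (is_derive_funM (is_derive_id h (1 : R)) (is_derive_funC (r - s) h 1)))).
      by rewrite mulr0 addr0 add0r mul1r.
    split.
    - have K := @is_derive1_comp R (fun q => Re (packet phi q p)) (fun h => s + h * (r - s)) h _ _ D1 dl.
      apply: (is_derive_eq K).
      by rewrite /g' !complexReIm /=; ring.
    - have K := @is_derive1_comp R (fun q => Im (packet phi q p)) (fun h => s + h * (r - s)) h _ _ D2 dl.
      apply: (is_derive_eq K).
      by rewrite /g' !complexReIm /=; ring.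
  rewrite /g' !ComplexField.Normc.normcM normc_real.
  rewrite [X in X * _ * _](_ : _ = n%:R); last first.
    by rewrite /= expr0n/= add0r sqrrN sqrtr_sqr ger0_norm.
  rewrite ler_wpM2l ?mulr_ge0//; apply: HC.
  apply: le_trans (ler_normD _ _) _; rewrite lerD2l normrM (ger0_norm h0).
  by rewrite mulr_ile1.
rewrite g1 g0 => B1 B2; apply: le_trans (normc_le _) _; rewrite !complexReIm.
apply: le_trans (lerD B1 B2) _; rewrite le_eqVlt; apply/orP; left; apply/eqP; ring.
Qed.

(* [W <= 1], so that [W ^+ 2] is integrable. *)
Lemma L2norm_dominated : exists kappa : R, 0 <= kappa /\
  forall (f : heis -> R[i]) (C : R), 0 <= C -> cmeasurable f ->
    (forall p, normc (f p) <= C * W p) -> (L2norm f <= (C * kappa)%:E)%E.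
Proof.
(* The integral of [W] is one factor pi for each of the 2 n + 1 coordinates, and it bounds the
   integral of its square. *)
exists (Num.sqrt (pi ^+ (n + n).+1)); split; first exact: sqrtr_ge0.
move=> f C C0 mf fC; rewrite /L2norm unlock.
have pi0 : 0 <= pi ^+ (n + n).+1 :> R by rewrite exprn_ge0// pi_ge0.
have W1 p : W p <= 1.
  have c1 x : 0 <= (cauchy_fun x : R) <= 1.
    rewrite (ltW (cauchy_fun_gt0 _))/= /cauchy_fun invf_le1 ?ltr_wpDr ?sqr_ge0//.
    by rewrite lerDl sqr_ge0.
  have cp (F : 'I_n -> R) : 0 <= \prod_(j < n) cauchy_fun (F j) <= 1.
    elim/big_ind: _ => [|x y /andP[x0 x1] /andP[y0 y1]|j _]; [by rewrite ler01 lexx| |exact: c1].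
    by rewrite mulr_ge0//= mulr_ile1.
  have /andP[x0 x1] := cp (fun j => p.1.1 ord0 j).
  have /andP[y0 y1] := cp (fun j => p.1.2 ord0 j).
  have /andP[c2 c3] := c1 p.2.
  by rewrite /heis_prod !mulr_ile1// mulr_ge0.
have E p : ((normc (f p))%:E `^ 2 <= (C ^+ 2)%:E * (W p)%:E)%E.
  rewrite poweR_EFin -EFinM lee_fin powR_mulrn ?normc_ge0//.
  apply: le_trans (_ : (C * W p) ^+ 2 <= _).
    by rewrite ler_pXn2r ?nnegrE ?normc_ge0// mulr_ge0// (ltW (heis_cauchy_gt0 _)).
  by rewrite exprMn ler_wpM2l ?sqr_ge0// expr2 ler_piMl// (ltW (heis_cauchy_gt0 _)).
have mW := measurable_funEFin (measurable_heis_prod (n := n) (@measurable_cauchy_fun R)).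
have I : (\int[@heis_measure R n]_p (`|(normc (f p))%:E| `^ 2)
   <= (C ^+ 2 * pi ^+ (n + n).+1)%:E)%E.
  rewrite EFinM -(integral_heis_prod n (@measurable_cauchy_fun R) _ (@integral_cauchy_fun R)); last first.
    by move=> x; rewrite ltW// cauchy_fun_gt0.
  rewrite -ge0_integralZl//; last 2 first.
  - by move=> p _; rewrite lee_fin (ltW (heis_cauchy_gt0 _)).
  - by rewrite lee_fin sqr_ge0.
  apply: ge0_le_integral => //.
  - by move=> p _; exact: poweR_ge0.
  - rewrite (_ : (fun p => _) = (fun p => (normc (f p) ^+ 2)%:E)).
      by apply: measurable_funEFin; apply: measurable_funX; exact: measurable_normc.
    apply/funext => p; rewrite gee0_abs ?lee_fin ?normc_ge0//.
    by rewrite poweR_EFin powR_mulrn ?normc_ge0.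
  - by apply: emeasurable_funM => //; exact: measurable_cst.
  - by move=> p _; rewrite /= ger0_norm ?normc_ge0//; exact: E.
apply: le_trans (gt0_ler_poweR _ _ _ I) _.
- by rewrite invr_ge0.
- by rewrite in_itv/= leey andbT; apply: integral_ge0 => p _; rewrite /= lee_fin powR_ge0.
- by rewrite in_itv/= leey andbT lee_fin mulr_ge0// sqr_ge0.
rewrite poweR_EFin lee_fin powR12_sqrt ?mulr_ge0 ?sqr_ge0// sqrtrM ?sqr_ge0//.
by rewrite sqrtr_sqr ger0_norm.
Qed.

Lemma packet_cCk0 phi s : cCk 0 phi -> supported alpha phi -> cCk 0 (packet phi s : heis -> R[i]).
Proof.
by move=> cp sp; exact: cCkS (cCkS ((packet_classical alpha_gt0 cp sp).1 s)).
Qed.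

Lemma cCk0_cmeasurable (f : heis -> R[i]) : cCk 0 f -> cmeasurable f.
Proof. by move=> [[c1 _] [c2 _]]; split; exact: continuous_measurable_heis. Qed.

Lemma packet_inL2 phi s : (forall k, cCk k phi) -> supported alpha phi ->
  inL2 (packet phi s : heis -> R[i]).
Proof.
move=> cp sp; have mp := cCk0_cmeasurable (packet_cCk0 s (cp 0%N) sp); split => //.
have [C [C0 HC]] := packet_dominated `|s| cp sp.
have [kappa [_ Hk]] := L2norm_dominated.
by apply: le_lt_trans (Hk _ _ C0 mp (fun p => HC s p (lexx _))) _; rewrite ltry.
Qed.

Lemma packet_L2_continuous phi s : (forall k, cCk k phi) -> supported alpha phi ->
  (@L2norm R n (fun p => packet phi r p - packet phi s p) @[r --> s] --> 0%E)%classic.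
Proof.
move=> cp sp.
have [C [C0 HC]] := packet_lipschitz s cp sp.
have [kappa [k0 Hk]] := L2norm_dominated.
have c0 : ((`|r - s| * C * kappa)%:E @[r --> s] --> 0%E)%classic.
  apply: cvg_EFin; first exact: nearW.
  rewrite /comp /= -[X in (_ --> X)%classic](mul0r (C * kappa)).
  under eq_fun do rewrite -mulrA.
  apply: cvgM; last exact: cvg_cst.
  by apply/norm_cvg0P/subr_cvg0; exact: cvg_id.
apply: (@squeeze_cvge _ _ _ _ (cst 0%E) _ (fun r => (`|r - s| * C * kappa)%:E)) => //; last exact: cvg_cst.
near=> r; rewrite Lnorm_ge0/=; apply: Hk.
- by rewrite mulr_ge0.
- apply: cCk0_cmeasurable; apply: cCkD; first exact: packet_cCk0 (cp 0%N) sp.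
  by apply: cCkN; exact: packet_cCk0 (cp 0%N) sp.
- move=> p; apply: HC; near: r.
  by apply/nbhs_ballP; exists 1 => //= r; rewrite /ball /= distrC => /ltW.
Unshelve. all: by end_near. Qed.

End bounds.

(** * Symmetry of the sub-Laplacian *)

Section weak.
Context {R : realType} {n : nat}.
Local Notation heis := (heis R n).
Implicit Types (f g F U psi : heis -> R[i]) (p v : heis).
Variable K : set heis.
Hypotheses (cK : compact K) (clK : closed K).

Definition csmooth f := forall k, cCk k f.

(** The compact set is fixed instead of being the support of [F], so that derivatives, products and
    sums remain in one class. *)
Definition test_on F := csmooth F /\ forall p, ~ K p -> F p = 0.

Lemma csmooth_derive f v : csmooth f -> csmooth (fun p => cderive f p v).
Proof. by move=> sf k; exact: cCk_cderive. Qed.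

Lemma csmooth_real (c : heis -> R) : (forall k, Ck k c) -> csmooth (fun p => (c p)%:C%C).
Proof. by move=> sc k; exact: cCk_real. Qed.

Lemma csmoothM f g : csmooth f -> csmooth g -> csmooth (fun p => f p * g p).
Proof. by move=> sf sg k; exact: cCkM. Qed.

Lemma csmoothD f g : csmooth f -> csmooth g -> csmooth (fun p => f p + g p).
Proof. by move=> sf sg k; exact: cCkD. Qed.

Lemma csmoothN f : csmooth f -> csmooth (fun p => - f p).
Proof. by move=> sf k; exact: cCkN. Qed.

Lemma csmooth_half_x j : csmooth (fun p => (p.1.1 ord0 j / 2)%:C%C).
Proof.
by apply: csmooth_real => k; apply: CkM; [exact: Ck_heis_x|exact: Ck_cst].
Qed.

Lemma csmooth_half_y j : csmooth (fun p => (p.1.2 ord0 j / 2)%:C%C).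
Proof.
by apply: csmooth_real => k; apply: CkM; [exact: Ck_heis_y|exact: Ck_cst].
Qed.

Lemma csmooth_vecX j f : csmooth f -> csmooth (vecX j f).
Proof.
move=> sf; apply: csmoothD; first exact: csmooth_derive.
by apply: csmoothM; [exact: csmooth_half_y|exact: csmooth_derive].
Qed.

Lemma csmooth_vecY j f : csmooth f -> csmooth (vecY j f).
Proof.
move=> sf; apply: csmoothD; first exact: csmooth_derive.
by apply: csmoothN; apply: csmoothM; [exact: csmooth_half_x|exact: csmooth_derive].
Qed.

Lemma csmooth_derivable f : csmooth f -> forall p v, cderivable f p v.
Proof. by move=> sf p v; exact: (cCk_cderivable p v (sf 1%N)). Qed.

Lemma test_onM f F : csmooth f -> test_on F -> test_on (fun p => f p * F p).
Proof.
by move=> sf [sF F0]; split; [exact: csmoothM|move=> p /F0 ->; rewrite mulr0].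
Qed.

Lemma test_onD F G : test_on F -> test_on G -> test_on (fun p => F p + G p).
Proof.
by move=> [sF F0] [sG G0]; split; [exact: csmoothD|move=> p Kp; rewrite F0// G0// addr0].
Qed.

Lemma test_onN F : test_on F -> test_on (fun p => - F p).
Proof.
by move=> [sF F0]; split; [exact: csmoothN|move=> p Kp; rewrite F0// oppr0].
Qed.

Lemma test_on_derive F v : test_on F -> test_on (fun p => cderive F p v).
Proof.
move=> [sF F0]; split; first exact: csmooth_derive.
move=> p nKp.
have nz : \forall q \near p, F q = 0.
  have : nbhs p (~` K) by apply: open_nbhs_nbhs; split => //; exact: closed_openC.
  by apply: filterS => q /F0.
apply: complex_ext => /=.
- rewrite -(derive_cst (0 : R) p v); apply: near_eq_derive => //.
  by apply: filterS nz => q /= ->.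
- rewrite -(derive_cst (0 : R) p v); apply: near_eq_derive => //.
  by apply: filterS nz => q /= ->.
Qed.

Lemma test_on_vecX j F : test_on F -> test_on (vecX j F).
Proof.
move=> tF; apply: test_onD; first exact: test_on_derive.
by apply: (test_onM (csmooth_half_y j)); exact: test_on_derive.
Qed.

Lemma test_on_vecY j F : test_on F -> test_on (vecY j F).
Proof.
move=> tF; apply: test_onD; first exact: test_on_derive.
by apply: test_onN; apply: (test_onM (csmooth_half_x j)); exact: test_on_derive.
Qed.

Lemma support_sub (f : heis -> R) : (forall p, ~ K p -> f p = 0) ->
  compact (closure [set p | f p != 0]).
Proof.
move=> f0; apply: (subclosed_compact _ cK); first exact: closed_closure.
rewrite closureE => p; apply; split => // q /= fq; apply: contrapT => /f0 E.
by move: fq; rewrite E eqxx.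
Qed.

Lemma test_on_tame F : test_on F -> tame (fun p => Re (F p)) /\ tame (fun p => Im (F p)).
Proof.
move=> [sF F0]; split; apply: tame_compact_support.
- exact: Ck_continuous (sF 0%N).1.
- by apply: support_sub => p /F0 ->.
- exact: Ck_continuous (sF 0%N).2.
- by apply: support_sub => p /F0 ->.
Qed.

Lemma test_on_cintegrable F : test_on F -> cintegrable heis_measure F.
Proof.
by move=> /test_on_tame[t1 t2]; split; [exact: tame_integrable t1|exact: tame_integrable t2].
Qed.

Lemma cintegral_cderive F v : test_on F ->
  cintegral heis_measure (fun p => cderive F p v) = 0.
Proof.
move=> [sF F0]; apply: complex_ext => /=; apply: integral_derive_compact_support.
- exact: (sF 1%N).1.
- by apply: support_sub => p /F0 ->.
- exact: (sF 1%N).2.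
- by apply: support_sub => p /F0 ->.
Qed.

(* The coefficient of [dir_t] in [X_j] does not depend on [t], so that [X_j] is divergence free. *)
Lemma cintegral_vecX j F : test_on F -> cintegral heis_measure (vecX j F) = 0.
Proof.
move=> tF.
have tG := test_onM (csmooth_half_y j) tF.
have -> : vecX j F = fun p => cderive F p (dir_x j) +
    cderive (fun p => (p.1.2 ord0 j / 2)%:C%C * F p) p dir_t.
  apply/funext => p; rewrite /vecX; congr (_ + _); apply/esym.
  apply: cis_derive_val; apply: cis_derive_eq.
    apply: (@cis_deriveM _ _ (fun p : heis => (p.1.2 ord0 j / 2)%:C%C) F).
      by apply: cis_derive_real; apply: is_derive_half; exact: is_derive_heis_y.
    exact: cderivableP (csmooth_derivable tF.1 _ _).
  by rewrite mxE !mul0r add0r.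
rewrite cintegralD ?cintegral_cderive ?addr0//;
  by apply: test_on_cintegrable; exact: test_on_derive.
Qed.

Lemma cintegral_vecY j F : test_on F -> cintegral heis_measure (vecY j F) = 0.
Proof.
move=> tF.
have tG := test_onN (test_onM (csmooth_half_x j) tF).
have -> : vecY j F = fun p => cderive F p (dir_y j) +
    cderive (fun p => - ((p.1.1 ord0 j / 2)%:C%C * F p)) p dir_t.
  apply/funext => p; rewrite /vecY; congr (_ + _); apply/esym.
  apply: cis_derive_val; apply: cis_derive_eq.
    apply: cis_deriveN; apply: (@cis_deriveM _ _ (fun p : heis => (p.1.1 ord0 j / 2)%:C%C) F).
      by apply: cis_derive_real; apply: is_derive_half; exact: is_derive_heis_x.
    exact: cderivableP (csmooth_derivable tF.1 _ _).
  by rewrite mxE !mul0r add0r.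
rewrite cintegralD ?cintegral_cderive ?addr0//;
  by apply: test_on_cintegrable; exact: test_on_derive.
Qed.

Lemma test_on_sum (I : Type) (r : seq I) (F : I -> heis -> R[i]) :
  (forall i, test_on (F i)) -> test_on (fun p => \sum_(i <- r) F i p).
Proof.
move=> tF; elim: r => [|i r IH].
  under eq_fun do rewrite big_nil.
  by split => // k; exact: cCk_cst.
by under eq_fun do rewrite big_cons; exact: test_onD.
Qed.

Lemma cintegral_sum0 (I : Type) (r : seq I) (F : I -> heis -> R[i]) :
  (forall i, test_on (F i)) -> (forall i, cintegral heis_measure (F i) = 0) ->
  cintegral heis_measure (fun p => \sum_(i <- r) F i p) = 0.
Proof.
move=> tF F0; elim: r => [|i r IH].
  under eq_fun do rewrite big_nil.
  by apply: complex_ext; rewrite /= /Rintegral integral0.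
under eq_fun do rewrite big_cons.
rewrite cintegralD ?F0 ?IH ?addr0//; apply: test_on_cintegrable => //.
exact: test_on_sum.
Qed.

(** Green identity: U X X psi - (X X U) psi = X (U X psi - (X U) psi), and likewise for Y; a field
    applied to a function vanishing off [K] has integral 0. Signs cancel over the two integrations
    by parts, and no conjugate appears since [pairing] is bilinear. *)
Lemma pairing_sublaplacian U psi : csmooth U -> test_on psi ->
  pairing U (sublaplacian psi) = pairing (sublaplacian U) psi.
Proof.
move=> sU tpsi; have [spsi _] := tpsi.
pose GX j p := U p * vecX j psi p - vecX j U p * psi p.
pose GY j p := U p * vecY j psi p - vecY j U p * psi p.
have tGX j : test_on (GX j).
  apply: test_onD; first by apply: test_onM => //; exact: test_on_vecX.
  by apply: test_onN; apply: test_onM => //; exact: csmooth_vecX.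
have tGY j : test_on (GY j).
  apply: test_onD; first by apply: test_onM => //; exact: test_on_vecY.
  by apply: test_onN; apply: test_onM => //; exact: csmooth_vecY.
have dU := csmooth_derivable sU; have dpsi := csmooth_derivable spsi.
have E p : U p * sublaplacian psi p = sublaplacian U p * psi p +
    \sum_(j < n) (vecX j (GX j) p + vecY j (GY j) p).
  rewrite /sublaplacian mulr_sumr mulr_suml -big_split/=; apply: eq_bigr => j _.
  have dX f : csmooth f -> forall p v, cderivable (vecX j f) p v.
    by move=> sf; exact: csmooth_derivable (csmooth_vecX j sf).
  have dY f : csmooth f -> forall p v, cderivable (vecY j f) p v.
    by move=> sf; exact: csmooth_derivable (csmooth_vecY j sf).
  have d1 := csmooth_derivable (csmoothM sU (csmooth_vecX j spsi)).
  have d2 := csmooth_derivable (csmoothM (csmooth_vecX j sU) spsi).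
  have d3 := csmooth_derivable (csmoothM sU (csmooth_vecY j spsi)).
  have d4 := csmooth_derivable (csmoothM (csmooth_vecY j sU) spsi).
  rewrite (vecXB j (d1 p) (d2 p)) (vecYB j (d3 p) (d4 p)).
  rewrite (vecXM j (dU p) (dX _ spsi p)) (vecXM j (dX _ sU p) (dpsi p)).
  rewrite (vecYM j (dU p) (dY _ spsi p)) (vecYM j (dY _ sU p) (dpsi p)).
  move: (vecX j (vecX j psi) p) (vecX j (vecX j U) p) (vecX j psi p) (vecX j U p).
  move: (vecY j (vecY j psi) p) (vecY j (vecY j U) p) (vecY j psi p) (vecY j U p).
  by move: (U p) (psi p) => a b c d e f g h k l; ring.
rewrite /pairing; under eq_fun do rewrite E.
have tXY j : test_on (fun p => vecX j (GX j) p + vecY j (GY j) p).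
  by apply: test_onD; [exact: test_on_vecX|exact: test_on_vecY].
have sL : csmooth (sublaplacian U).
  move=> k; rewrite /sublaplacian; elim: (index_enum _) => [|j r IH].
    by under eq_fun do rewrite big_nil; exact: cCk_cst.
  under eq_fun do rewrite big_cons; apply: cCkD => //.
  apply: cCkD; [exact: (csmooth_vecX j (csmooth_vecX j sU))|exact: (csmooth_vecY j (csmooth_vecY j sU))].
rewrite cintegralD; last 2 first.
- by apply: test_on_cintegrable; exact: test_onM.
- by apply: test_on_cintegrable; exact: test_on_sum.
rewrite [X in _ + X]cintegral_sum0 ?addr0// => j.
have tX := test_on_vecX j (tGX j); have tY := test_on_vecY j (tGY j).
rewrite (cintegralD (test_on_cintegrable tX) (test_on_cintegrable tY)).
by rewrite (cintegral_vecX j (tGX j)) (cintegral_vecY j (tGY j)) addr0.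
Qed.

End weak.

(** * The packet as a weak solution *)

Section weak_packet.
Context {R : realType} {n : nat}.
Local Notation heis := (heis R n).
Variable alpha : R.
Hypothesis alpha_gt0 : 0 < alpha.
Implicit Types (phi : R -> R[i]).

Lemma packet_csmooth phi s : cCk 0 phi -> supported alpha phi ->
  csmooth (packet phi s : heis -> R[i]).
Proof.
move=> cp sp k; rewrite (_ : packet phi s = packet_init (rot (- (n%:R * s)) phi)).
  by apply: (cCk_packet_init alpha_gt0); [exact: rot_cCk0|exact: rot_supported].
by apply/funext => p; exact: (packet_rot alpha_gt0).
Qed.

Lemma packet_weak phi (psi : heis -> R[i]) s : cCk 0 phi -> supported alpha phi ->
  test_function psi ->
  cderivable (fun r : R => pairing (packet phi r) psi) s (1 : R) /\
  'i%C * cderive (fun r : R => pairing (packet phi r) psi) s (1 : R)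
    + pairing (packet phi s) (sublaplacian psi) = 0.
Proof.
move=> cp sp [spsi cpsi].
pose K := closure [set p | psi p != 0].
have clK : closed K by exact: closed_closure.
have tpsi : test_on K psi.
  split => // p Kp; apply/eqP; apply: contrapT => /negP pp; apply: Kp.
  exact: subset_closure.
have clp := lmul_cCk cp; have slp := lmul_supported sp.
pose f (r : R) (p : heis) := packet phi r p * psi p.
pose f' (r : R) (p : heis) := (0 +i* (- n%:R))%C * (packet (lmul phi) r p * psi p).
have iN m (ph : R -> R[i]) : cCk 0 ph -> supported alpha ph ->
    cintegrable heis_measure (fun p : heis => packet ph m p * psi p).
  move=> c s0; apply: (test_on_cintegrable cpsi clK); apply: test_onM => //.
  exact: packet_csmooth.
have df r p : cis_derive (f^~ p) r (1 : R) (f' r p).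
  apply: cis_derive_eq.
    apply: (@cis_deriveM _ _ (fun r => packet phi r p) (fun=> psi p)); last exact: cis_derive_cst.
    exact: (cis_derive_packet_time alpha_gt0).
  by rewrite /f' mulr0 addr0 mulrA.
(* A majorant independent of time: packets of [lmul phi] are bounded everywhere by its mass, and
   [psi] supplies the integrability. *)
pose G (p : heis) := n%:R * mass (lmul phi) * normc (psi p).
have iG : heis_measure.-integrable setT (EFin \o G).
  apply: integrable_scale; apply: cintegrable_normc; exact: (test_on_cintegrable cpsi clK).
have f'G r p : normc (f' r p) <= G p.
  rewrite /f' /G !ComplexField.Normc.normcM -!mulrA.
  have -> : normc (0 +i* (- n%:R))%C = n%:R :> R.
    by rewrite /= expr0n/= add0r sqrrN sqrtr_sqr ger0_norm.
  rewrite ler_wpM2l// ler_wpM2r ?normc_ge0//.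
  apply: le_trans (normc_packet alpha_gt0 _ _ clp slp) _.
  rewrite ler_piMl ?mass_ge0// -[leRHS]expR0 ler_expR.
  by rewrite mulNr mulNr oppr_le0 divr_ge0// mulr_ge0 ?znorm2_ge0// ltW.
have D : cis_derive (fun r : R => pairing (packet phi r) psi) s (1 : R) (cintegral heis_measure (f' s)).
  split.
  - apply: (@is_derive_under_integral _ _ _ heis_measure (fun h p => Re (f h p)) (fun h p => Re (f' h p)) s G) => //.
    + by move=> h _; exact: (iN h _ cp sp).1.
    + by move=> h p _; exact: (df h p).1.
    + by move=> h p _; apply: le_trans (normc_Re _) (f'G _ _).
  - apply: (@is_derive_under_integral _ _ _ heis_measure (fun h p => Im (f h p)) (fun h p => Im (f' h p)) s G) => //.
    + by move=> h _; exact: (iN h _ cp sp).2.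
    + by move=> h p _; exact: (df h p).2.
    + by move=> h p _; apply: le_trans (normc_Im _) (f'G _ _).
split; first exact: cis_derivable D.
rewrite (cis_derive_val D) (pairing_sublaplacian cpsi clK (packet_csmooth s cp sp) tpsi).
rewrite /pairing.
have -> : sublaplacian (packet phi s) =
    (fun p : heis => (- n%:R)%:C%C * packet (lmul phi) s p) :> (heis -> R[i]).
  apply/funext => p.
  have -> : packet phi s = packet_init (rot (- (n%:R * s)) phi) :> (heis -> R[i]).
    by apply/funext => q; exact: (packet_rot alpha_gt0).
  rewrite (sublaplacian_packet_init alpha_gt0); [|exact: rot_cCk0|exact: rot_supported].
  rewrite lmul_rot -(packet_rot alpha_gt0)// -mulNr; congr (_ * _).
  by apply: complex_ext; rewrite !complexReIm /= ?oppr0.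
under [in X in _ + X]eq_fun do rewrite -mulrA.
rewrite /f' !cintegralZ//; [|exact: iN|exact: iN].
rewrite mulrA -mulrDl [X in X * _](_ : _ = 0) ?mul0r//.
by apply: complex_ext; rewrite !complexReIm /=; ring.
Qed.

Lemma packet_L2_solution phi : (forall k, cCk k phi) -> supported alpha phi ->
  L2_solution (packet_init phi : heis -> R[i]) (packet phi).
Proof.
move=> cp sp.
have p0 p : packet phi 0 p = packet_init phi p :> R[i].
  by rewrite /packet mulr0 subr0; case: p.
split.
- have -> : packet_init phi = packet phi 0 :> (heis -> R[i]) by apply/funext => p; rewrite p0.
  exact: (packet_inL2 alpha_gt0).
- by move=> s; exact: (packet_inL2 alpha_gt0).
- by apply/aeW => p.
- by move=> s; exact: (packet_L2_continuous alpha_gt0).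
- by move=> psi tpsi s; exact: packet_weak.
Qed.

End weak_packet.

(** * Failure of the uncertainty principle *)

Section bump.
Context {R : realType}.

(* [x^-m exp (-1/x)], extended by 0: the span of these functions is stable under derivation. *)
Definition flat (m : nat) (x : R) : R :=
  if 0 < x then x^-1 ^+ m * expR (- x^-1) else 0.

Lemma flat_le0 m x : x <= 0 -> flat m x = 0.
Proof. by rewrite /flat leNgt => /negbTE ->. Qed.

(** With y = 1/x this is e^y >= y^(m+2) / (m+2)!. The two spare powers of [x] make the derivative at
    0 vanish. *)
Lemma flat_bound m (x : R) : `|flat m x| <= (m.+2)`!%:R * x ^+ 2.
Proof.
have [x0|x0] := lerP x 0.
  by rewrite flat_le0// normr0 mulr_ge0// sqr_ge0.
have : 0 < x^-1 by rewrite invr_gt0.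
rewrite /flat x0 -[X in _ * X ^+ 2]invrK; move: x^-1 => y y0.
rewrite ger0_norm ?mulr_ge0 ?exprn_ge0 ?expR_ge0 ?(ltW y0)//.
rewrite expRN ler_pdivrMr ?expR_gt0// exprVn mulrAC ler_pdivlMr ?exprn_gt0// -exprD addn2.
rewrite mulrC -ler_pdivrMr ?ltr0n ?fact_gt0//.
by apply: le_trans (expR_ge1Dxn m.+1 (ltW y0)); rewrite lerDr.
Qed.

Lemma is_derive_flat m (x : R) :
  is_derive x 1 (flat m) (flat m.+2 x - m%:R * flat m.+1 x).
Proof.
have [x0|x0|->] := ltgtP x 0.
- rewrite !(flat_le0 _ (ltW x0)) mulr0 subr0.
  apply: (near_eq_is_derive _ (is_derive_funC (0 : R) x (1 : R))).
  by near=> y; rewrite flat_le0// ltW//; near: y; exact: lt_nbhsl.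
- pose F (y : R) := y^-1 ^+ m * expR (- y^-1).
  have xn0 : x != 0 by rewrite gt_eqF.
  have dV : is_derive x (1 : R) (fun y : R => y^-1) (- x ^- 2).
    apply: (is_derive_eq (is_deriveV xn0 (is_derive_id x (1 : R)))).
    by rewrite /GRing.scale /= mulr1.
  have dX : is_derive x (1 : R) (fun y : R => y^-1 ^+ m) (m%:R * x^-1 ^+ m.-1 * (- x ^- 2)).
    by have := is_deriveX m dV; rewrite exprfctE.
  have dE : is_derive x (1 : R) (fun y : R => expR (- y^-1)) (expR (- x^-1) * x ^- 2).
    have dN : is_derive x (1 : R) (fun y : R => - y^-1) (x ^- 2).
      by apply: (is_derive_eq (is_deriveN dV)); rewrite opprK.
    exact: (@is_derive1_comp R expR (fun y : R => - y^-1) x _ _ (is_derive_expR _) dN).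
  apply: (@near_eq_is_derive _ _ _ F).
    by near=> y; rewrite /flat ifT//; near: y; exact: lt_nbhsr.
  apply: (is_derive_eq (is_derive_funM dX dE)).
  rewrite /flat x0; case: m F dX => [|m] F dX /=; rewrite ?exprS; field => //.
- rewrite !(flat_le0 _ (lexx 0)) mulr0 subr0.
  (* By [flat_bound] the difference quotient at 0 is at most (m+2)! |h|. *)
  have H : h^-1 *: ((flat m \o shift 0) (h *: 1) - flat m 0) @[h --> 0^'] --> (0 : R).
    apply/norm_cvg0P.
    have cB : (m.+2)`!%:R * `|h| @[h --> (0:R)^'] --> (0 : R).
      rewrite -[X in _ --> X](mulr0 ((m.+2)`!%:R)); apply: cvgM; first exact: cvg_cst.
      rewrite -[X in _ --> X](@normr0 _ R); apply: cvg_norm.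
      by apply: cvg_within_filter; exact: cvg_id.
    apply: (@squeeze_cvgr _ _ _ _ (cst 0) _ _ _ _ _ cB); last exact: cvg_cst.
    near=> h; rewrite [cst 0 h]/(0:R) normr_ge0/=.
    have hn0 : h != 0 by near: h; exact: nbhs_dnbhs_neq.
    have -> : h *: (1 : R) = h by exact: mulr1.
    rewrite addr0 (flat_le0 m (lexx 0)) subr0 normrM normfV mulrC ler_pdivrMr ?normr_gt0//.
    by rewrite -mulrA -expr2 real_normK ?num_real//; exact: flat_bound.
  apply: DeriveDef; first by apply/cvg_ex; exists 0.
  exact/cvg_lim.
Unshelve. all: by end_near. Qed.

Lemma Ck_flat k m : Ck k (flat m).
Proof.
elim: k m => [|k IH] m; have D x := is_derive_flat m x; split => //;
  try by move=> x; apply: differentiable_continuous; apply/derivable1_diffP;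
    exact: (ex_derive (is_derive := D x)).
move=> v.
have Dv x := is_derive_dir v (D x).
split; first by move=> x; exact: (ex_derive (is_derive := Dv x)).
rewrite (_ : (fun p => 'D_v (flat m) p) = (fun x => v * (flat m.+2 x - m%:R * flat m.+1 x))).
  apply: CkM; first exact: Ck_cst.
  by apply: CkB; [exact: IH|apply: CkM; [exact: Ck_cst|exact: IH]].
by apply/funext => x; exact: (derive_val (is_derive := Dv x)).
Qed.

Lemma Ck_affine k (f : R -> R) (a b : R) : Ck k f -> Ck k (fun x => f (a * x + b)).
Proof.
elim: k f => [|k IH] f kf.
  split => // x; apply: (@continuous_comp _ _ _ (fun x : R => a * x + b) f); last exact: kf.1.
  by apply: cvgD; [apply: cvgM; [exact: cvg_cst|exact: cvg_id]|exact: cvg_cst].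
have D x : is_derive x (1 : R) (fun x => f (a * x + b)) ('D_1 f (a * x + b) * a).
  have da : is_derive x (1 : R) (fun x : R => a * x + b) a.
    apply: (is_derive_eq (is_derive_funD (is_derive_funM (is_derive_funC a x 1) (is_derive_id x (1 : R))) (is_derive_funC b x 1))).
    by rewrite mul0r add0r mulr1 addr0.
  exact: (@is_derive1_comp R f (fun x : R => a * x + b) x _ _ (derivableP (Ck_derivable kf)) da).
split.
  by move=> x; apply: differentiable_continuous; apply/derivable1_diffP; exact: (ex_derive (is_derive := D x)).
move=> v; have Dv x := is_derive_dir v (D x).
split; first by move=> x; exact: (ex_derive (is_derive := Dv x)).
rewrite (_ : (fun p => 'D_v _ p) = (fun x => v * ('D_1 f (a * x + b) * a))).
  apply: CkM; first exact: Ck_cst.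
  by apply: CkM; [exact: (IH _ (Ck_derive _ kf))|exact: Ck_cst].
by apply/funext => x; exact: (derive_val (is_derive := Dv x)).
Qed.

Definition bump (alpha x : R) : R := flat 0 (x - alpha) * flat 0 (alpha + 1 - x).

Lemma Ck_bump k alpha : Ck k (bump alpha).
Proof.
apply: CkM.
- rewrite (_ : (fun x => _) = (fun x => flat 0 (1 * x + - alpha))); last first.
    by apply/funext => x; rewrite mul1r.
  by apply: Ck_affine; exact: Ck_flat.
- rewrite (_ : (fun x => _) = (fun x => flat 0 (-1 * x + (alpha + 1)))); last first.
    by apply/funext => x; rewrite mulN1r addrC.
  by apply: Ck_affine; exact: Ck_flat.
Qed.

Lemma bump_supported alpha : supported alpha (fun x => (bump alpha x)%:C%C).
Proof.
move=> x; rewrite negb_and -!ltNge /bump => /orP[h|h].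
  by rewrite (@flat_le0 0 (x - alpha)) ?mul0r// subr_le0 ltW.
by rewrite (@flat_le0 0 (alpha + 1 - x)) ?mulr0// subr_le0 ltW.
Qed.

Lemma flat0_ge0 x : 0 <= flat 0 x.
Proof. by rewrite /flat; case: ifP => // _; rewrite expr0 mul1r expR_ge0. Qed.

Lemma bump_ge0 alpha x : 0 <= bump alpha x.
Proof. by rewrite mulr_ge0 ?flat0_ge0. Qed.

Lemma flat0_quarter x : 4^-1 <= x -> expR (- 4) <= flat 0 x.
Proof.
move=> x4; have x0 : 0 < x by lra.
by rewrite /flat x0 expr0 mul1r ler_expR lerN2 -[leRHS]invrK lef_pV2 ?posrE ?invr_gt0.
Qed.

Lemma Rintegral_bump_gt0 alpha : 0 < alpha ->
  0 < Rintegral (@lebesgue_measure R) setT (bump alpha).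
Proof.
move=> a0; set leb := @lebesgue_measure R.
have ib : leb.-integrable setT (EFin \o bump alpha).
  apply: (@integrable_supported R alpha); first exact: Ck_continuous (Ck_bump 0 alpha).
  by move=> l /(@bump_supported alpha) [].
(* On the middle half of the support both factors of the bump have argument at least 1/4, hence
   value at least e^-4. *)
pose I := `[alpha + 4^-1, alpha + 3 / 4]%classic.
have mI : measurable (I : set (measurableTypeR R)) by exact: measurable_itv.
rewrite -lte_fin /Rintegral fineK; last exact: integrable_fin_num.
have mb : measurable_fun (setT : set (measurableTypeR R)) (EFin \o bump alpha) by exact: measurable_int ib.
apply: (@lt_le_trans _ _ (\int[leb]_(x in I) (bump alpha x)%:E)%E); last first.
  by apply: ge0_subset_integral => // x _; rewrite lee_fin bump_ge0.
apply: (@lt_le_trans _ _ (\int[leb]_(x in I) (cst (expR (- 4) * expR (- 4))%:E x))%E); last first.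
  apply: ge0_le_integral => //.
  - by move=> x _; rewrite /= lee_fin mulr_ge0 ?expR_ge0.
  - exact: measurable_funTS mb.
  - move=> x; rewrite /I /= in_itv/= => /andP[h1 h2]; rewrite lee_fin.
    by apply: ler_pM; rewrite ?expR_ge0// flat0_quarter//; lra.
have EI : leb I = (2^-1)%:E.
  apply: etrans (lebesgue_measure_itv `[alpha + 4^-1, alpha + 3 / 4]) _.
  by rewrite /= lte_fin ifT; [rewrite -EFinB; congr (_%:E); field|lra].
by rewrite integral_cst//; rewrite [X in (_ * X)%E]EI -EFinM lte_fin !mulr_gt0 ?expR_gt0// invr_gt0.
Qed.

End bump.

(** * Packets satisfying the decay hypotheses *)

Section counterexample.
Context {R : realType} {n : nat}.
Local Notation heis := (heis R n).
Variable alpha : R.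
Hypothesis alpha_gt0 : 0 < alpha.
Implicit Types (phi : R -> R[i]).

(** If [f 0] were nonzero, [f] would have no zero on a small cube around 0. The indicator of that
    cube would then vanish almost everywhere, although its integral is (2 d)^(2n+1) > 0. *)
Lemma ae_zero_continuous (f : heis -> R) : continuous f ->
  {ae heis_measure, forall p, f p = 0} -> f 0 = 0.
Proof.
move=> cf f0; apply/eqP; apply: contrapT => /negP fn0.
have : \forall p \near (0 : heis), f p != 0.
  exact: cvgr_neq0 (cf 0) fn0.
move=> /nbhs_ballP[e /= e0 He].
(* Halving keeps the closed cube inside the open ball of radius [e]. *)
pose d := e / 2; have d0 : 0 < d by rewrite divr_gt0.
pose g (x : R) : R := \1_(`[- d, d]%classic) x.
have mg : measurable_fun setT g by apply: measurable_indic; exact: measurable_itv.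
have g0 x : 0 <= g x by rewrite /g indicE.
have gI : (\int[@lebesgue_measure R]_x (g x)%:E = (2 * d)%:E)%E.
  have mI : measurable (`[- d, d]%classic : set (measurableTypeR R)) by exact: measurable_itv.
  apply: etrans (integral_indic (@lebesgue_measure R) measurableT mI) _; rewrite setIT.
  apply: etrans (lebesgue_measure_itv `[- d, d]) _.
  by rewrite /= lte_fin ifT; [rewrite -EFinB; congr (_%:E); ring|lra].
have := integral_heis_prod n mg g0 gI.
rewrite (ae_eq_integral (cst 0%E)) ?integral0//.
- by move=> /eqP; rewrite eqe => /eqP E; have := exprn_gt0 (n + n).+1 (mulr_gt0 (ltr0n _ 2) d0 : 0 < 2 * d); rewrite -E ltxx.
- exact: measurable_funEFin (measurable_heis_prod mg).
- move: f0; apply: filterS => p fp _; congr (_%:E).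
  apply/eqP; apply: contraT => gp.
  have gin x : g x != 0 -> `|0 - x| < e.
    rewrite /g indicE sub0r normrN; case: (boolP (x \in _)) => [|_]; last by rewrite eqxx.
    rewrite inE /= in_itv/= => /andP[h1 h2] _; rewrite ltr_norml.
    by apply/andP; split; rewrite /d in h1 h2; lra.
  move: gp; rewrite /heis_prod !mulf_eq0 !negb_or => /andP[/andP[/prodf_neq0 hx /prodf_neq0 hy] ht].
  have : f p != 0.
    apply: He; apply: heis_ball => // [j|j|].
    + by rewrite mxE; apply: gin; exact: hx.
    + by rewrite mxE; apply: gin; exact: hy.
    + exact: gin.
  by rewrite fp eqxx.
Qed.

Lemma packet_gaussian_decay phi (s a : R) k : (forall k, cCk k phi) -> supported alpha phi ->
  0 < a -> (a ^+ 2)^-1 <= alpha ->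
  gaussian_decay a (fun t => (1 + `|t|) ^- k) (packet phi s : heis -> R[i]).
Proof.
move=> cp sp a0 aal.
(* Moves the weight from t to t' = t - n s: 1 + |t| <= (1 + |n s|) (1 + |t'|), followed by (1 + r)^k
   <= 2^k (1 + r^k), which is seen by separating r <= 1 from r > 1. *)
pose c := (1 + `|n%:R * s|) ^+ k * 2 ^+ k.
exists (c * (mass phi + mass (nderiv k phi))); apply/aeW => p.
set E := expR (- alpha * znorm2 p / 4); set N := normc (packet phi s p).
set t' := p.2 - n%:R * s.
have H1 : N <= E * mass phi by exact: normc_packet.
have H2 : `|t'| ^+ k * N <= E * mass (nderiv k phi).
  apply: le_trans (normc_packet_pow alpha_gt0 s p k cp sp).
  rewrite ler_wpM2r ?normc_ge0// lerXn2r ?nnegrE ?sqrtr_ge0//.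
  by rewrite -sqrtr_sqr ler_wsqrtr// lerDl divr_ge0// sqr_ge0.
have c0 : 0 <= c by rewrite mulr_ge0 ?exprn_ge0 ?addr_ge0.
have t1 : (1 + `|p.2|) ^+ k <= c * (1 + `|t'| ^+ k).
  apply: le_trans (_ : ((1 + `|n%:R * s|) * (1 + `|t'|)) ^+ k <= _).
    rewrite lerXn2r ?nnegrE ?mulr_ge0 ?addr_ge0//.
    have -> : p.2 = t' + n%:R * s by rewrite /t' subrK.
    have := ler_normD t' (n%:R * s).
    have : 0 <= `|n%:R * s| * `|t'| by rewrite mulr_ge0.
    by move=> h1 h2; rewrite mulrDl mul1r mulrDr mulr1; lra.
  rewrite exprMn /c -mulrA ler_wpM2l ?exprn_ge0 ?addr_ge0//.
  have [h|h] := lerP `|t'| 1.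
    apply: le_trans (_ : 2 ^+ k <= _).
      by rewrite lerXn2r ?nnegrE ?addr_ge0//; lra.
    by rewrite ler_peMr ?exprn_ge0// lerDl exprn_ge0.
  apply: le_trans (_ : 2 ^+ k * `|t'| ^+ k <= _).
    by rewrite -exprMn lerXn2r ?nnegrE ?addr_ge0 ?mulr_ge0//; lra.
  by rewrite ler_wpM2l ?exprn_ge0// lerDr.
have tk : 0 < (1 + `|p.2|) ^+ k by rewrite exprn_gt0// ltr_wpDr.
rewrite mulrA ler_pdivlMr//.
apply: le_trans (_ : N * (c * (1 + `|t'| ^+ k)) <= _).
  by rewrite ler_wpM2l ?normc_ge0.
have -> : N * (c * (1 + `|t'| ^+ k)) = c * (N + `|t'| ^+ k * N) by ring.
rewrite -[leRHS]mulrA ler_wpM2l//; apply: le_trans (lerD H1 H2) _.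
rewrite -mulrDr mulrC ler_wpM2l ?addr_ge0 ?mass_ge0// ler_expR.
have z0 := znorm2_ge0 p.
have -> : - znorm2 p / (4 * a ^+ 2) = - ((a ^+ 2)^-1 * znorm2 p / 4).
  by field; rewrite gt_eqF.
by rewrite !mulNr lerN2 ler_wpM2r// ler_wpM2r.
Qed.

(** At the origin and at time 0 the exponent is 0, so the packet is the integral of the bump, which
    is positive; continuity turns this into nonvanishing on a set of positive measure. *)
Lemma packet_bump_neq0 :
  ~ {ae heis_measure, forall p : heis, packet (fun x => (bump alpha x)%:C%C) 0 p = 0}.
Proof.
move=> ae0; pose phi := fun x : R => (bump alpha x)%:C%C.
have cp k : cCk k phi by apply: cCk_real; exact: Ck_bump.
have sp : supported alpha phi by exact: bump_supported.
have cR : continuous (fun p : heis => Re (packet phi 0 p)).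
  exact: (packet_cCk0 alpha_gt0 0 (cp 0%N) sp).1.1.
have ae0R : {ae heis_measure, forall p : heis, Re (packet phi 0 p) = 0}.
  by apply: filterS ae0 => p ->.
have := ae_zero_continuous cR ae0R.
rewrite (packet_wave alpha_gt0 0 0 sp).
have -> : wt ((0 : heis).1, (0 : heis).2 - n%:R * 0) = 0 :> R[i].
  apply: complex_ext; rewrite /= ?mulr0 ?subr0//.
  by rewrite /znorm2 big1 ?mul0r ?oppr0// => j _; rewrite !mxE expr0n addr0.
have cexp0 : cexp (0 : R[i]) = 1.
  by apply: complex_ext; rewrite ?Re_cexp ?Im_cexp /= expR0 ?cos0 ?sin0 ?mulr0 ?mulr1.
have -> : Re (wave phi 0) = Rintegral (@lebesgue_measure R) setT (bump alpha).
  by apply: eq_Rintegral => l _; rewrite mulr0 cexp0 mul1r.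
by move=> /eqP; rewrite gt_eqF// Rintegral_bump_gt0.
Qed.

End counterexample.

Theorem mainTheorem4 (R : realType) (n : nat) (n_gt0 : (0 < n)%N) :
  (forall (alpha : R) (phi : R -> R[i]),
     0 < alpha -> schwartz phi ->
     closure [set l | phi l != 0] `<=` `[alpha, alpha + 1] ->
     let u0 : heis R n -> R[i] := packet_init phi in
     let u : R -> heis R n -> R[i] := packet phi in
     [/\ classical_solution u /\ (forall p, u 0 p = u0 p),
         L2_solution u0 u,
         forall (s : R) (p : heis R n), 0 < s ->
           ((normc (u s p))%:E
              <= L1norm phi * (expR (- alpha * znorm2 p / 4))%:E)%E
       & forall (k : nat) (s : R) (p : heis R n), 0 < s ->
           let D := (p.2 - n%:R * s) ^+ 2 + znorm2 p ^+ 2 / 16 in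
           0 < D ->
           ((normc (u s p))%:E
              <= L1norm (nderiv k phi)
                 * (expR (- alpha * znorm2 p / 4) / D `^ (k%:R / 2))%:E)%E])
  /\
  (forall a b T : R, 0 < a -> 0 < b -> 0 < T -> a * b < T ->
     ~ hardy_dynamical n (fun t => expR (- (0 * `|t|))) a b T
     /\ forall k : nat,
        ~ hardy_dynamical n (fun t => (1 + `|t|) ^- k) a b T).
Proof.
split=> [alpha phi alpha_gt0 [dphi _] sphi u0 u|a b T a0 b0 T0 _].
  have cphi := cderivable_cCk dphi.
  have supp : supported alpha phi.
    move=> l lN; apply/eqP; apply: contraT => phil.
    have /sphi : closure [set l | phi l != 0] l by exact: subset_closure.
    by rewrite /= in_itv/= (negbTE lN).
  split.
  - split; first exact: (packet_classical alpha_gt0 (cphi 0%N) supp).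
    by move=> p; rewrite /u /packet mulr0 subr0; case: p.
  - exact: (packet_L2_solution alpha_gt0).
  - by move=> s p _; exact: (L1norm_packet_bound alpha_gt0).
  - by move=> k s p _; exact: (L1norm_packet_decay alpha_gt0).
(* Exceeds both [(a ^+ 2)^-1] and [(b ^+ 2)^-1], so the single Gaussian factor of the packet meets
   the hypotheses at time 0 and at time [T]. *)
pose alpha := (a ^+ 2)^-1 + (b ^+ 2)^-1.
have a20 : 0 < (a ^+ 2)^-1 by rewrite invr_gt0 exprn_gt0.
have b20 : 0 < (b ^+ 2)^-1 by rewrite invr_gt0 exprn_gt0.
have alpha_gt0 : 0 < alpha by exact: addr_gt0.
pose phi (x : R) := (bump alpha x)%:C%C.
have cphi k : cCk k phi by apply: cCk_real; exact: Ck_bump.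
have supp : supported alpha phi by exact: bump_supported.
have u00 : packet_init phi = packet phi 0 :> (heis R n -> R[i]).
  by apply/funext => p; rewrite /packet mulr0 subr0; case: p.
have H k : ~ hardy_dynamical n (fun t => (1 + `|t|) ^- k) a b T.
  move=> hardy.
  (* The principle would make the packet vanish at every time; time 0 gives the contradiction. *)
  apply: (packet_bump_neq0 (n := n) alpha_gt0).
  apply: (hardy _ _ (packet_L2_solution alpha_gt0 cphi supp)).
  - rewrite u00; apply: (packet_gaussian_decay alpha_gt0) => //.
    by rewrite lerDl ltW.
  - apply: (packet_gaussian_decay alpha_gt0) => //.
    by rewrite lerDr ltW.
split => //.
(* For delta = 0 the exponential weight is constantly 1, the polynomial weight of degree 0. *)
rewrite (_ : (fun t => _) = (fun t : R => (1 + `|t|) ^- 0)); first exact: H.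
by apply/funext => t; rewrite mul0r oppr0 expR0 expr0 invr1.
Qed.
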